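(* Let $\Gamma$ be a finitely generated dense just infinite subgroup of a profinite group $G$. Then $\liminf_{U\unlhd_o G}\frac{d({\rm H}_1(U;\widehat{\mathbb{Z}}))}{|G:U|}=0$.
   Context: A just infinite group is an infinite group all of whose non-trivial normal subgroups have finite index. For a profinite group $G$, the (lower) normal homology rank gradient is $\liminf_{U\unlhd_o G}\frac{d({\rm H}_1(U;\widehat{\mathbb{Z}}))}{|G:U|}=\sup_{V\unlhd_o G}\inf_{U\unlhd_o G,\,U\le V}\frac{d({\rm H}_1(U;\widehat{\mathbb{Z}}))}{|G:U|}$, where $U$ ranges over open normal subgroups, $d(\cdot)$ denotes the minimal number of (topological) generators, and ${\rm H}_1(U;\widehat{\mathbb{Z}})\cong U/\overline{[U,U]}$. *)

(* Defs.v *)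
From HB Require Import structures.
From mathcomp Require Import all_boot all_order all_algebra.
From mathcomp Require Import all_classical all_reals all_analysis.
From mathcomp Require Import Rstruct Rstruct_topology.

Set Implicit Arguments.
Unset Strict Implicit.
Unset Printing Implicit Defensive.

Import Order.TTheory GRing.Theory Num.Theory.
Local Open Scope classical_set_scope.

Section GroupDefs.
Variables (T : Type) (mul : T -> T -> T) (inv : T -> T) (one : T).

Definition group_axioms : Prop :=
  [/\ forall x y z, mul x (mul y z) = mul (mul x y) z,
      forall x, mul one x = x,
      forall x, mul x one = x,
      forall x, mul (inv x) x = one &
      forall x, mul x (inv x) = one].

Definition subgroup (H : set T) : Prop :=
  [/\ H one, forall x y, H x -> H y -> H (mul x y) & forall x, H x -> H (inv x)].

Definition normal_in (K H : set T) : Prop :=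
  [/\ subgroup H, H `<=` K &
      forall k h, K k -> H h -> H (mul (mul (inv k) h) k)].

Definition gen (S : set T) : set T :=
  [set x | forall H, subgroup H -> S `<=` H -> H x].

Definition comm_sub (U : set T) : set T :=
  gen [set mul (mul (inv a) (inv b)) (mul a b) | a in U & b in U].

Definition index_in (K H : set T) (n : nat) : Prop :=
  exists f : 'I_n -> T, (forall i, K (f i)) /\
    forall x, K x -> exists! i : 'I_n, H (mul (inv (f i)) x).

Definition finite_index (K H : set T) : Prop := exists n, index_in K H n.

Definition fin_gen (K : set T) : Prop :=
  exists (n : nat) (s : 'I_n -> T), K = gen (range s).

Definition just_infinite (K : set T) : Prop :=
  subgroup K /\ infinite_set K /\
  forall N, normal_in K N -> N <> [set one] -> finite_index K N.
End GroupDefs.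

Section TopDefs.
Variables (T : topologicalType) (mul : T -> T -> T) (inv : T -> T) (one : T).

Definition topological_group : Prop :=
  [/\ group_axioms mul inv one,
      continuous (fun p : T * T => mul p.1 p.2) & continuous inv].

Definition profinite_group : Prop :=
  [/\ topological_group, compact [set: T], hausdorff_space T &
      totally_disconnected [set: T]].

Definition open_normal (U : set T) : Prop :=
  open U /\ normal_in mul inv one [set: T] U.

(* U / closure [U,U] (= H_1(U; Zhat)) is topologically generated by n elements:
   the images of u_1..u_n generate a dense subgroup of U / cl[U,U], i.e.
   the closure of <u_1,..,u_n, [U,U]> is U. *)
Definition ab_top_gen (U : set T) (n : nat) : Prop :=
  exists s : 'I_n -> T, (forall i, U (s i)) /\
    closure (gen mul inv one (range s `|` comm_sub mul inv one U)) = U.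

(* d(H_1(U; Zhat)) as an extended real (+oo if not finitely generated) *)
Definition dH1 (U : set T) : \bar Rdefinitions.R :=
  ereal_inf [set (n%:R)%:E | n in ab_top_gen U].

Definition dH1_ratio (U : set T) : \bar Rdefinitions.R :=
  ereal_inf [set (dH1 U * ((m%:R)^-1)%:E)%E | m in index_in mul inv [set: T] U].

Definition normal_homology_rank_gradient : \bar Rdefinitions.R :=
  ereal_sup [set ereal_inf [set dH1_ratio U | U in [set U | open_normal U /\ U `<=` V]]
            | V in open_normal].
End TopDefs.

(* Main.v *)
Require Import Defs.
From HB Require Import structures.
From mathcomp Require Import all_boot all_order all_algebra.
From mathcomp Require Import all_fingroup all_solvable.
From mathcomp Require Import zify.

(** Suppose that d(H_1(U)) >= |G:U|/K for all open normal U <= V.  For x <> 1 in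
    Gamma the closure M of the normal closure of x is open, and H_1(M) is
    generated by the conjugates of x, one for each double coset of C(x) and M.
    Taking x = y^k shows that the order of y modulo M is at most K.  Hence Gamma
    is torsion, and some coset y X0, with y of order o > 1 modulo X0, consists of
    elements of order o.

    Let w in Gamma lie deep in X0, of prime order p, let U be the closure of its
    normal closure, m = |G:U|, and let U1 be the closure of [U,U].  Then
    E = U/U1 is elementary abelian of rank at least m/K.  As <<y^k>> has finite
    index in Gamma, the rank of [E, y^k] also grows linearly in m for 0 < k < o.

    Since (y v)^o = 1 for v in U1, the norm 1 + y + ... + y^(o-1) kills
    A = U1/[U1,U1].  Translating by elements of E and eliminating terms,
    prod_(0<k<o) (1 - a_k) kills A for all a_k in [E, y^k].  Choosing L ~ c m
    independent batches (a_k), the abelian group A is generated over a set of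
    E-generators, of size quadratic in m, by a proportion
    (1 - (1 - 1/p)^(o-1))^L <= (1 - 2^(1-o))^L of the elements of E.  This decays
    exponentially in m, which contradicts d(H_1(U1)) >= m|E|/K. *)

Set Implicit Arguments.
Unset Strict Implicit.
Unset Printing Implicit Defensive.
Import Order.TTheory GRing.Theory Num.Theory.

(** * Finite groups *)

(** The norm relation by itself saves only a constant proportion of the |E| translates, while the
    E-generators of A already cost an extra factor m. So the saving has to be repeated in a number
    of batches linear in m, and the batches have to be independent: reduced monomials are restricted
    in each batch separately, and the proportions multiply. Room for so many batches comes from E
    being generated by w as a module under conjugation. The coinvariants of E under <<y^k>> are
    spanned by the w^r with r in a transversal of <<y^k>> in Gamma, and [E, <<y^k>>] is a product of
    conjugates of [E, y^k], one for each of finitely many conjugates of y^k that generate <<y^k>>.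
    Both numbers are fixed before w, whereas m grows with the depth of w. The prime order of w turns
    E into a vector space, where independence can be read off from orders. The conjugates of w also
    bound the rank of E by m; hence U1 is open, and the assumed lower bound applies to U1 as
    well. *)

Section FiniteGroups.
Local Open Scope group_scope.
Variable gT : finGroupType.
Implicit Types (E P : {group gT}).

Lemma abelian_join_bound E c (l : seq {group gT}) :
    abelian E -> all (fun G : {group gT} => (G \subset E) && (#|G| <= c)) l ->
  exists P, [/\ P \subset E, #|P| <= c ^ size l &
                all (fun G : {group gT} => G \subset P) l].
Proof.
move=> abE; elim: l => [_|G l IHl /= /andP[/andP[sGE leGc] /IHl[P [sPE leP sP]]]].
  by exists 1%G; rewrite sub1G cards1 expn0.
have cGP : G \subset 'C(P) by rewrite (subset_trans sGE) // (subset_trans abE) // centS.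
exists (G <*> P)%G; split.
- by rewrite join_subG sGE.
- rewrite /= (cent_joinEr (subset_trans sPE (subset_trans abE (centS sGE)))) expnS.
  apply: leq_trans (leq_mul leGc leP).
  by rewrite mul_cardG leq_pmulr ?cardG_gt0.
- rewrite joing_subl /=; apply: sub_all sP => H sHP.
  exact: subset_trans sHP (joing_subr _ _).
Qed.

(** Writing x = r n gives w ^ x = w ^ r * [~ w ^ r, n], and commutators of E with the group
    generated by the z ^ g lie in the product of the I :^ g. So E is generated by the conjugates of
    I over [F] together with the w ^ r over [R]. *)
Lemma coinvariants_bound E (I : {group gT}) (w z : gT) (p : nat) (F R : seq gT) :
    abelian E -> E <| [set: gT] -> E :=: <<w ^: [set: gT]>> ->
    0 < p -> w ^+ p = 1 -> I \subset E -> {in E, forall e, [~ e, z] \in I} ->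
    (forall x, exists2 r, r \in R &
       exists2 n, n \in <<[set z ^ g | g in F]>> & x = r * n) ->
  #|E| <= #|I| ^ size F * p ^ size R.
Proof.
move=> abE /andP[_ nE] defE p_gt0 wp1 sIE comI covR.
have Jin e g : (e ^ g \in E) = (e \in E) by rewrite memJ_norm // (subsetP nE) ?inE.
have wE x : w ^ x \in E by rewrite defE mem_gen // memJ_class ?inE.
have [|P1 [sP1 leP1 /allP inP1]] :=
  @abelian_join_bound E #|I| [seq (I :^ g)%G | g <- F] abE.
  apply/allP=> _ /mapP[g _ ->]; rewrite /= cardJg leqnn andbT.
  by rewrite -(normP (subsetP nE g (in_setT g))) conjSg.
have [|P2 [sP2 leP2 /allP inP2]] :=
  @abelian_join_bound E p [seq <[w ^ r]>%G | r <- R] abE.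
  apply/allP=> _ /mapP[g _ ->]; rewrite /= cycle_subG wE /=.
  by rewrite -orderE orderJ; apply: dvdn_leq => //; rewrite order_dvdn wp1.
rewrite !size_map in leP1 leP2.
have c12 : P2 \subset 'C(P1).
  by rewrite (subset_trans sP2) // (subset_trans abE) // centS.
suff sEP : E \subset P1 * P2.
  apply: leq_trans (leq_mul leP1 leP2).
  apply: leq_trans (subset_leq_card sEP) _.
  by rewrite mul_cardG leq_pmulr ?cardG_gt0.
rewrite -(cent_joinEr c12) defE gen_subG.
apply/subsetP=> _ /imsetP[x _ ->].
have [r rR [n nZ ->]] := covR x.
suff com : {in E, forall e, [~ e, n] \in P1}.
  have -> : w ^ (r * n) = w ^ r * [~ w ^ r, n] by rewrite conjgM mulKVg.
  rewrite groupM //=.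
    rewrite (subsetP (joing_subr P1 P2)) //.
    by apply: (subsetP (inP2 _ (map_f _ rR))); rewrite cycle_id.
  by rewrite (subsetP (joing_subl P1 P2)) // com.
(* Closed under products: [e, q r'] = [e, r'] [e, q]^r', and the last factor differs from [e, q] by
   the commutator with r' of [e, q], which is again an element of E. *)
pose S := [set q | [forall e in E, [~ e, q] \in P1]].
have gS : group_set S.
  apply/group_setP; split.
    by rewrite inE; apply/forall_inP=> e _; rewrite commg1 group1.
  move=> q r'; rewrite !inE => /forall_inP Hq /forall_inP Hr.
  apply/forall_inP=> e eE; rewrite commgMJ groupM ?Hr //.
  have qE := subsetP sP1 _ (Hq e eE).
  have -> : [~ e, q] ^ r' = [~ e, q] * [~ [~ e, q], r'] by rewrite mulKVg.
  by rewrite groupM ?Hr ?Hq.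
suff : n \in Group gS by rewrite inE => /forall_inP.
apply: subsetP nZ; rewrite gen_subG; apply/subsetP=> _ /imsetP[g gF ->].
rewrite inE; apply/forall_inP=> e eE.
apply: (subsetP (inP1 _ (map_f _ gF))) => /=.
have -> : [~ e, z ^ g] = [~ e ^ g^-1, z] ^ g by rewrite conjRg conjgKV.
by rewrite memJ_conjg comI // Jin.
Qed.

(** Greedy choice: the span of the elements chosen so far has order p ^ size s, less than p ^ #|I|,
    so it contains no J i that is still to be served. The uniform lower bound replaces a condition
    of Hall type. *)
Lemma independent_choice (I : finType) (J : I -> {group gT}) E p :
    prime p -> p.-abelem E -> (forall i, J i \subset E) ->
    (forall i, p ^ #|I| <= #|J i|) ->
  exists2 a : I -> gT, forall i, a i \in J i &
    #|<<[set a i | i : I]>>| = (p ^ #|I|)%N.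
Proof.
move=> pr_p abE sJE leJ.
suff H (s : seq I) : uniq s -> exists2 a : I -> gT, forall i, a i \in J i &
    #|<<[set a i | i in s]>>| = (p ^ size s)%N.
  have [a aJ Ha] := H (enum I) (enum_uniq I); exists a => //.
  rewrite [#|I|]cardT -Ha; congr #|<<_>>|.
  by apply/setP=> x; apply/imsetP/imsetP=> -[i _ ->]; exists i; rewrite ?mem_enum.
elim: s => [_|i s IHs /= /andP[is_ us]].
  exists (fun=> 1) => [i|]; first exact: group1.
  rewrite expn0; apply/eqP; rewrite -trivg_card1 -subG1 gen_subG.
  by apply/subsetP=> x /imsetP[j]; rewrite in_nil.
have [a aJ cardB] := IHs us.
have cp x (G : {group gT}) : x \in E -> G \subset E -> x \notin G ->
    #|<<x |: G>>| = (p * #|G|)%N.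
  move=> xE sGE xG; have ox : #[x] = p.
    by rewrite (abelem_order_p abE) //; apply: contraNneq xG => ->; rewrite group1.
  rewrite -joingE -joing_idl -/(cycle x) cent_joinEl; last first.
    by rewrite cycle_subG (subsetP (subset_trans (abelem_abelian abE) (centS sGE))).
  rewrite TI_cardMg ?orderE -?ox //; apply: prime_TIg; first by rewrite -orderE ox.
  by rewrite cycle_subG.
have sBE : <<[set a i | i in s]>> \subset E.
  by rewrite gen_subG; apply/subsetP=> _ /imsetP[j _ ->]; apply: (subsetP (sJE j)).
have [x xJ xB] : exists2 x, x \in J i & x \notin <<[set a i | i in s]>>.
  apply/subsetPn; apply/negP=> /subset_leq_card.
  rewrite cardB leqNgt (leq_trans _ (leJ i)) // ltn_exp2l ?prime_gt1 //.
  have /card_uniqP e : uniq (i :: s) by rewrite /= is_.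
  by rewrite -[(size s).+1]/(size (i :: s)) -e max_card.
exists (fun j => if j == i then x else a j) => [j|]; first by case: eqP => [->|].
rewrite expnS -cardB -(cp x [group of <<[set a i | i in s]>>]) ?(subsetP (sJE i)) //=.
congr #|_|; rewrite -joingE joing_idr joingE; congr <<_>>.
apply/setP=> y; rewrite in_setU1; apply/imsetP/predU1P.
  case=> j; rewrite inE => /predU1P[->|js] ->; first by left; rewrite eqxx.
  right; case: eqP => [ji|_]; first by rewrite -ji js in is_.
  by apply/imsetP; exists j.
case=> [->|/imsetP[j js ->]]; first by exists i; rewrite ?mem_head ?eqxx.
exists j; first by rewrite inE js orbT.
by case: eqP => // ji; rewrite -ji js in is_.
Qed.

End FiniteGroups.

(** * Norm relations and products of operators 1 - g *)

Section NormElimination.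
Local Open Scope ring_scope.
Variables (gT : finGroupType) (V : zmodType) (act : V -> gT -> V).
Hypothesis actB : forall u v g, act (u - v) g = act u g - act v g.
Hypothesis actM : forall v g h, act v (g * h)%g = act (act v g) h.
Hypothesis act1 : forall v, act v 1%g = v.

Fixpoint aug (s : seq gT) (v : V) : V :=
  if s is g :: s' then aug s' v - act (aug s' v) g else v.

Variables (E : {group gT}) (y : gT) (o : nat).
Hypothesis abE : abelian E.
Hypothesis yE : y \in 'N(E)%g.
Hypothesis o_gt0 : (0 < o)%N.
Hypothesis norm0 : forall v, \sum_(i < o) act v (y ^+ i)%g = 0.

(** The coefficient at index i of the norm relation after the eliminations recorded in [s]: the
    product of the differences h ^ (y ^+ i) - h ^ (y ^+ k). It vanishes at every recorded k. *)
Fixpoint elim (s : seq (nat * gT)) (i : nat) (v : V) : V :=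
  if s is (k, h) :: s' then
    act (elim s' i v) (h ^ (y ^+ i))%g - act (elim s' i v) (h ^ (y ^+ k))%g
  else v.

Lemma act0 g : act 0 g = 0.
Proof. by rewrite -[X in act X _](subrr 0) actB subrr. Qed.

Lemma actN v g : act (- v) g = - act v g.
Proof. by rewrite -[- v]add0r actB act0 add0r. Qed.

Lemma actD u v g : act (u + v) g = act u g + act v g.
Proof. by rewrite -[X in u + X]opprK actB actN opprK. Qed.

Lemma act_sum n (F : 'I_n -> V) g :
  act (\sum_(i < n) F i) g = \sum_(i < n) act (F i) g.
Proof.
elim/big_rec2: _ => [|i u v _ <-]; by rewrite ?act0 ?actD.
Qed.

Lemma actC v : {in E &, forall g h, act (act v g) h = act (act v h) g}.
Proof. by move=> g h gE hE; rewrite -!actM (centsP abE _ gE). Qed.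

Lemma conj_in h i : h \in E -> (h ^ (y ^+ i))%g \in E.
Proof. by move=> hE; rewrite memJ_norm // groupX. Qed.

Lemma elimC s i e v : all (fun kh => kh.2 \in E) s -> e \in E ->
  act (elim s i v) e = elim s i (act v e).
Proof.
elim: s => //= -[k h] s IHs /= /andP[hE sE] eE.
by rewrite actB -(IHs sE eE) (actC _ (conj_in i hE)) // (actC _ (conj_in k hE)).
Qed.

(** Since h * y ^+ i = y ^+ i * h ^ (y ^+ i), the relation for [act v h] has the coefficient h ^ (y
    ^+ i) at index i; what is subtracted is one common translate of a sum that is already zero. *)
Lemma elim_sum0 s v : all (fun kh => kh.2 \in E) s ->
  \sum_(i < o) elim s i (act v (y ^+ i)%g) = 0.
Proof.
elim: s v => [v _|[k h] s IHs v /= /andP[hE sE]]; first exact: norm0.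
rewrite sumrB -act_sum IHs // act0 subr0 -[RHS](IHs (act v h) sE).
apply: eq_bigr => i _; rewrite elimC ?conj_in // -!actM; congr elim.
by rewrite -conjgC.
Qed.

Lemma elim_hit s i h v : (i, h) \in s -> elim s i v = 0.
Proof.
elim: s => //= -[k g] s IHs; rewrite inE => /predU1P[[<- <-]|/IHs ->].
  by rewrite subrr.
by rewrite !act0 subrr.
Qed.

Lemma aug0 s : aug s 0 = 0.
Proof. by elim: s => //= g s ->; rewrite act0 subrr. Qed.

Lemma augC s e v : all (mem E) s -> e \in E -> act (aug s v) e = aug s (act v e).
Proof.
elim: s => //= g s IHs /= /andP[gE sE] eE.
by rewrite actB (actC _ gE eE) IHs.
Qed.

(** At index 0 a factor is h - h ^ (y ^+ k) = h (1 - [h, y ^+ k]). The unit parts h commute with all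
    operators from E and are collected in [e]. *)
Lemma elim_aug (h : nat -> gT) s : (forall k, h k \in E) ->
  exists2 e, e \in E & forall v,
    elim [seq (k, h k) | k <- s] 0 v = aug [seq [~ h k, y ^+ k]%g | k <- s] (act v e).
Proof.
move=> hE.
have cE k : [~ h k, y ^+ k]%g \in E by rewrite groupM ?groupV ?conj_in.
elim: s => [|k s [e eE IHs]] /=; first by exists 1%g => //; rewrite act1.
have sE : all (mem E) [seq [~ h k, y ^+ k]%g | k <- s].
  by apply/allP=> _ /mapP[j _ ->]; exact: cE.
exists (e * h k)%g; first by rewrite groupM.
move=> v; rewrite IHs; have -> : (h k ^ (y ^+ k) = h k * [~ h k, y ^+ k])%g by rewrite mulKVg.
by rewrite expg0 conjg1 !actM -(augC _ sE (hE k)).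
Qed.

(* Translating the norm relation by h and subtracting h ^ (y ^+ k) times the
   original one eliminates the k-th term; after o.-1 steps only the term of
   index 0 is left. *)
Lemma aug_commutators_eq0 (h : nat -> gT) v : (forall k, h k \in E) ->
  aug [seq [~ h k, y ^+ k]%g | k <- iota 1 o.-1] v = 0.
Proof.
move=> hE; pose s := [seq (k, h k) | k <- iota 1 o.-1].
have sE : all (fun kh => kh.2 \in E) s by apply/allP=> _ /mapP[k _ ->]; exact: hE.
have el0 u : elim s 0 u = 0.
  have := elim_sum0 u sE; case: o o_gt0 @s sE => // n _ s sE.
  rewrite big_ord_recl /= act1 big1 ?addr0 // => i _.
  apply: (@elim_hit _ _ (h (lift ord0 i))).
  by apply/mapP; exists (lift ord0 i : nat); rewrite // mem_iota lift0 /= add1n ltnS ltn_ord.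
have [e eE aug_e] := elim_aug (iota 1 o.-1) hE.
(* The unit [e] is cancelled by taking the translate of v by its inverse. *)
by rewrite -[v]act1 -(mulVg e) actM -aug_e el0.
Qed.

End NormElimination.

(** * Rewriting monomials by augmentation relations *)

Section AdditiveSpan.
Local Open Scope ring_scope.
Variables (X V : zmodType) (act : V -> X -> V).
Hypothesis actB : forall u v x, act (u - v) x = act u x - act v x.
Hypothesis actD : forall v x y, act v (x + y) = act (act v x) y.
Hypothesis act0 : forall v, act v 0 = v.

Variable P : V -> Prop.
Hypothesis PB : forall u v, P u -> P v -> P (u - v).

(** The operators of [aug] with the acting group written additively: E will enter as the finite
    module [fmod_of abE], where monomials are big sums of multiples. *)
Fixpoint augx (s : seq X) (v : V) : V :=
  if s is x :: s' then augx s' v - act (augx s' v) x else v.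

Lemma augxB s u v : augx s (u - v) = augx s u - augx s v.
Proof.
by elim: s => //= x s ->; rewrite actB !opprD !opprK addrACA.
Qed.

Lemma augxC s x v : act (augx s v) x = augx s (act v x).
Proof.
by elim: s v => //= y s IHs v; rewrite actB -IHs -!actD [(y + x)%R]addrC.
Qed.
(** Expanding prod (1 - a_i) gives an alternating sum of the translates of v by all partial
    products, so modulo [P] the full product is a combination of the proper ones. The induction
    replaces v by v - v a_k. *)
Lemma span_augx (I : finType) (a : I -> X) (s : seq I) v : uniq s ->
    P (augx [seq a i | i <- s] v) ->
    (forall T : {set I}, T \proper [set i in s] -> P (act v (\sum_(i in T) a i))) ->
  P (act v (\sum_(i in [set i in s]) a i)).
Proof.
elim: s v => [v _ Pv _|k s IHs v /= /andP[ks us] Pv PT].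
  by rewrite big1 ?act0 // => i; rewrite !inE.
have ksT (T : {set I}) : T \subset [set i in s] -> k \notin T.
  by move=> sT; apply: contra ks => /(subsetP sT); rewrite inE.
have pk (T : {set I}) : T \subset [set i in s] -> T \proper [set i in k :: s].
  move=> sT; rewrite set_cons; apply/properP; split.
    exact: subset_trans sT (subsetUr _ _).
  by exists k; rewrite ?setU11 ?ksT.
have PsT : P (act v (\sum_(i in [set i in s]) a i)) by apply: PT; exact: pk.
have Pc : P (act (v - act v (a k)) (\sum_(i in [set i in s]) a i)).
  apply: IHs => //; first by rewrite augxB -augxC.
  move=> T pT; rewrite actB -actD -(big_setU1 _ (ksT _ (proper_sub pT))) /=.
  apply: PB; apply: PT; first exact/pk/proper_sub.
  have [sT [j js jT]] := properP pT.
  apply/properP; split; first by rewrite set_cons setUS.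
  exists j; first by rewrite set_cons setU1r.
  by rewrite in_setU1 negb_or jT andbT; apply: contraNneq ks => <-; rewrite inE in js.
rewrite set_cons big_setU1 ?inE //= actD.
rewrite actB in Pc; have := PB PsT Pc.
by rewrite -actD opprB addrC subrK.
Qed.

Definition monomial L n (a : 'I_L -> 'I_n -> X) (j : 'I_L -> 'I_n -> nat) : X :=
  \sum_l \sum_k a l k *+ j l k.

Lemma monomialD L n (a : 'I_L -> 'I_n -> X) (i j : 'I_L -> 'I_n -> nat) :
  monomial a (fun l k => i l k + j l k)%N = monomial a i + monomial a j.
Proof.
rewrite /monomial -big_split; apply: eq_bigr => l _ /=.
by rewrite -big_split; apply: eq_bigr => k _ /=; rewrite mulrnDr.
Qed.

Lemma monomial_row L n (a : 'I_L -> 'I_n -> X) l (T : {set 'I_n}) :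
  monomial a (fun l' k => (l' == l) && (k \in T)) = \sum_(k in T) a l k.
Proof.
have out l' : l' != l -> \sum_k a l' k *+ ((l' == l) && (k \in T)) = 0.
  by move/negPf=> ->; rewrite big1 // => k _; rewrite mulr0n.
rewrite /monomial (bigD1 l) //= [X in _ + X]big1 ?addr0 //.
by rewrite [RHS]big_mkcond; apply: eq_bigr => k _; rewrite eqxx /=; case: ifP.
Qed.

(* A monomial all of whose exponents in some batch are positive is rewritten
   by the augmentation relation of that batch into monomials with a smaller sum
   of exponents. *)
Lemma span_monomial L n p (a : 'I_L -> 'I_n -> X) v :
    (forall l u, augx [seq a l k | k <- enum 'I_n] u = 0) -> P 0 ->
    (forall j : 'I_L -> 'I_n -> nat, (forall l k, j l k < p)%N ->
       (forall l, exists k, j l k = 0%N) -> P (act v (monomial a j))) ->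
  forall j : 'I_L -> 'I_n -> nat, (forall l k, j l k < p)%N -> P (act v (monomial a j)).
Proof.
move=> aug0 P0 Pred j.
have [N] := ubnP (\sum_l \sum_k j l k)%N; elim: N j => // N IHN j ltN jp.
have [l0|/forallPn[l /existsPn jl]] := boolP [forall l, exists k, j l k == 0%N].
  apply: Pred => // l.
  by have /existsP[k /eqP] := forallP l0 l; exists k.
have j_gt0 k : (0 < j l k)%N by rewrite lt0n jl.
(* [j'] divides the monomial by the full product of batch l; multiplying back only a proper partial
   product gives a smaller sum of exponents than [j]. *)
pose j' l' k := (j l' k - (l' == l))%N.
have sumE (T : {set 'I_n}) : act v (monomial a (fun l' k => j' l' k + ((l' == l) && (k \in T)))%N) =
    act (act v (monomial a j')) (\sum_(k in T) a l k).
  by rewrite monomialD monomial_row actD.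
have jE l' k : (j' l' k + ((l' == l) && (k \in [set: 'I_n])))%N = j l' k.
  by rewrite inE andbT /j' subnK //; case: eqP => [->|].
have -> : monomial a j = monomial a (fun l' k => j' l' k + ((l' == l) && (k \in [set: 'I_n])))%N.
  by rewrite /monomial; apply: eq_bigr => l' _; apply: eq_bigr => k _; rewrite jE.
have setE : [set k in enum 'I_n] = [set: 'I_n] by apply/setP=> k; rewrite !inE mem_enum.
rewrite sumE -setE; apply: span_augx; rewrite ?enum_uniq ?aug0 //.
move=> T; rewrite setE => /properP[_ [k _ kT]]; rewrite -sumE.
have le_j l' k' : (j' l' k' + ((l' == l) && (k' \in T)) <= j l' k')%N.
  by rewrite -[X in (_ <= X)%N]jE leq_add2l inE andbT; case: (l' == l); case: (k' \in T).
apply: IHN => [|l' k']; last exact: leq_ltn_trans (le_j _ _) (jp _ _).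
rewrite -ltnS; apply: leq_trans ltN; rewrite ltnS.
rewrite (bigD1 l) //= [X in (_ < X)%N](bigD1 l) //= -addSn leq_add //; last first.
  by apply: leq_sum => l' _; apply: leq_sum => k' _; exact: le_j.
rewrite (bigD1 k) //= [X in (_ < X)%N](bigD1 k) //= -addSn leq_add //; last first.
  by apply: leq_sum => k' _; exact: le_j.
by rewrite eqxx (negPf kT) addn0 /j' eqxx subn1 prednK.
Qed.

End AdditiveSpan.

(** * A small set spanning all E-translates *)

Section SpanningSet.
Local Open Scope group_scope.
Variables (gT : finGroupType) (E : {group gT}) (y : gT) (o p L : nat).
Local Notation n := o.-1.
Variable h : 'I_L -> 'I_n -> gT.
Hypotheses (p_pr : prime p) (pE : p.-abelem E) (yE : y \in 'N(E)) (o_gt0 : 0 < o).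
Hypothesis hE : forall l k, h l k \in E.
Let c (i : 'I_L * 'I_n) := [~ h i.1 i.2, y ^+ i.2.+1].
Hypothesis card_c : #|<<[set c i | i : 'I_L * 'I_n]>>| = (p ^ (L * n))%N.

(* S is made of the monomials having a zero exponent in each batch, times a
   transversal; it does not depend on V, which will range over finite quotients
   of one and the same profinite module. *)
Lemma reduced_spanning_set : exists S : {set gT},
  [/\ S \subset E,
      (#|S| * p ^ (L * n) <= (p ^ n - p.-1 ^ n) ^ L * #|E|)%N &
      forall (V : zmodType) (act : V -> gT -> V) (P : V -> Prop) (v : V),
        (forall u v g, act (u - v)%R g = (act u g - act v g)%R) ->
        (forall v g h, act v (g * h) = act (act v g) h) ->
        (forall v, act v 1 = v) ->
        (forall v, (\sum_(i < o) act v (y ^+ i)%g = 0)%R) ->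
        P 0%R -> (forall u v, P u -> P v -> P (u - v)%R) ->
        {in S, forall s, P (act v s)} -> {in E, forall e, P (act v e)}].
Proof.
have abE : abelian E := abelem_abelian pE.
have cE i : c i \in E by rewrite groupM ?groupV ?memJ_norm ?groupX ?hE.
pose X := FiniteModule.fmod_of abE.
pose a l k : X := FiniteModule.fmod abE (c (l, k)).
have valE (x : X) : val x \in E := FiniteModule.fmodP x.
have xp (x : X) i : (x *+ (i %% p) = x *+ i)%R.
  rewrite [in RHS](divn_eq i p) mulrnDr mulnC mulrnA.
  suff -> : (x *+ p = 0)%R by rewrite mul0rn add0r.
  apply: val_inj; rewrite FiniteModule.fmvalZ.
  by have [_ ->] := abelemP p_pr pE.
pose J := {ffun 'I_L -> {ffun 'I_n -> 'I_p}}.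
pose monJ (j : J) : gT := val (monomial a (fun l k => j l k : nat)).
have p_gt0 := prime_gt0 p_pr.
have redJ (f : 'I_L -> 'I_n -> nat) : exists j : J, val (monomial a f) = monJ j.
  exists [ffun l => [ffun k => Ordinal (ltn_pmod (f l k) p_gt0)]].
  congr val; apply: eq_bigr => l _; apply: eq_bigr => k _.
  by rewrite !ffunE /= xp.
pose B := <<[set c i | i : 'I_L * 'I_n]>>%G; have cardB : #|B| = (p ^ (L * n))%N := card_c.
have sBE : B \subset E.
  by rewrite gen_subG; apply/subsetP=> _ /imsetP[i _ ->].
(* Exponents matter only modulo p, so the monomials with exponents below p form a subgroup; it
   contains every c i and hence B. *)
have covB b : b \in B -> exists j, b = monJ j.
  pose M := [set monJ j | j : J].
  have gM : group_set M.
    apply/group_setP; split.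
      have [j ej] := redJ (fun _ _ => 0%N); apply/imsetP; exists j => //.
      by rewrite -ej /monomial big1 // => l _; rewrite big1.
    move=> _ _ /imsetP[i _ ->] /imsetP[j _ ->].
    rewrite -[_ * _]/(val (monomial a (fun l k => i l k : nat) + monomial a (fun l k => j l k : nat))%R).
    by rewrite -monomialD; have [j' ->] := redJ (fun l k => i l k + j l k); exact: imset_f.
  suff sBM : B \subset Group gM by move/(subsetP sBM)/imsetP=> [j _ ->]; exists j.
  rewrite gen_subG; apply/subsetP=> _ /imsetP[[l k] _ ->].
  have [j] := redJ (fun l' k' => (l' == l) && (k' \in [set k])).
  rewrite monomial_row big_set1 FiniteModule.fmodK // => ->.
  exact: imset_f.
pose Red := ffun_on [pred g : {ffun 'I_n -> 'I_p} | [exists k, g k == 0 :> nat]] : {pred J}.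
pose Tr := [set repr C | C in rcosets B E].
exists [set monJ x.1 * x.2 | x in setX [set j in Red] Tr]; split.
- apply/subsetP=> _ /imsetP[[j t] /setXP[_ /imsetP[C /rcosetsP[g gE ->] ->]] ->] /=.
  have [b bB ->] := rcosetP (mem_repr_rcoset B g).
  by apply: groupM; [exact: valE|apply: groupM => //; exact: (subsetP sBE)].
(* Independence of the c i enters here: p ^ (L * n) is the order of B and cancels, leaving at most
   #|Red| elements for each coset of B. A row with a zero exponent is one of p^n - (p-1)^n. *)
- rewrite -cardB -(Lagrange sBE) [(#|B| * _)%N]mulnC mulnA leq_mul2r.
  apply/orP; right; apply: leq_trans (leq_imset_card _ _) _.
  rewrite cardsX leq_mul ?leq_imset_card // cardsE card_ffun_on card_ord //.
  have mono u v : (u <= v -> u ^ L <= v ^ L)%N.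
    by case: (posnP L) => [->|L_gt0]; rewrite ?expn0 // leq_exp2r.
  apply: mono.
  pose C : {pred {ffun 'I_n -> 'I_p}} := ffun_on [pred i : 'I_p | i != 0 :> nat].
  have -> : (p ^ n)%N = #|{ffun 'I_n -> 'I_p}| by rewrite card_ffun !card_ord.
  have <- : #|C| = (p.-1 ^ n)%N.
    rewrite card_ffun_on card_ord; congr (_ ^ _)%N.
    case: p p_gt0 => // p' _; have := cardC1 (ord0 : 'I_p'.+1).
    by rewrite card_ord => <-; apply: eq_card => i; rewrite !inE.
  rewrite -(cardC C) addKn; apply/subset_leq_card/subsetP=> g.
  rewrite !inE => /existsP[k gk]; apply/negP=> /ffun_onP/(_ k).
  by rewrite inE gk.
move=> V act P v actB actM act1 norm0 P0 PB PS e eE.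
pose actx v (x : X) := act v (val x).
have augE s u : augx actx s u = aug act [seq val x | x <- s] u.
  by elim: s => //= x s ->.
have augn l u : augx actx [seq a l k | k <- enum 'I_n] u = 0%R.
  rewrite augE -map_comp.
  (* Powers of y are numbered from 1 and the members of a batch from 0, hence the shift; the default
     1 keeps h' k in E for every k. *)
  pose h' k := oapp (h l) 1 (insub k.-1).
  have h'E k : h' k \in E by rewrite /h'; case: insubP => [i _ _|_] /=.
  rewrite -[RHS](aug_commutators_eq0 actB actM act1 abE yE o_gt0 norm0 u h'E).
  congr aug; rewrite -[1%N]addn0 iotaDl -val_enum_ord -!map_comp.
  apply: eq_map => k /=; rewrite FiniteModule.fmodK // /h' add1n /=.
  by rewrite valK.
have /rcosetP[b bB def_r] := mem_repr_rcoset B e.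
have [j def_b] := covB _ (groupVr bB).
have -> : e = monJ j * repr (B :* e) by rewrite -def_b def_r mulKg.
set t := repr _.
have tTr : t \in Tr by apply: imset_f; apply/rcosetsP; exists e.
have actxB u w x : actx (u - w)%R x = (actx u x - actx w x)%R by exact: actB.
have actxD u x z : actx u (x + z)%R = actx (actx u x) z by rewrite /actx -actM.
have actx0 u : actx u 0%R = u by exact: act1.
(* The coset representative acts last and is absorbed into the predicate, so that only monomials
   remain to be rewritten. *)
pose P' u := P (act u t).
have PB' u w : P' u -> P' w -> P' (u - w)%R by rewrite /P' actB; exact: PB.
have P0' : P' 0%R by rewrite /P' (act0 actB).
rewrite actM.
apply: (span_monomial actxB actxD actx0 PB' augn P0' (p := p)) => [f fp f0|l k] //.
rewrite /P' /actx -actM; apply: PS.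
pose jf : J := [ffun l => [ffun k => Ordinal (fp l k)]].
apply/imsetP; exists (jf, t).
  rewrite inE /= tTr andbT inE; apply/ffun_onP=> l; rewrite inE.
  by apply/existsP; have [k fk] := f0 l; exists k; rewrite !ffunE /= fk.
rewrite /monJ /=; congr (val _ * _).
by apply: eq_bigr => l _; apply: eq_bigr => k _; rewrite !ffunE.
Qed.
End SpanningSet.

(** * Commutators in finite groups and powers of y b *)

Section MoreFinite.
Local Open Scope group_scope.
Variable gT : finGroupType.

(** The U-conjugates of the commutators of generators generate a subgroup normalised by U; modulo it
    the generators commute, so U becomes abelian. *)
Lemma commg_gen_in (U H : {group gT}) (D : {set gT}) : U :=: <<D>> ->
    (forall a b u, a \in D -> b \in D -> u \in U -> [~ a, b] ^ u \in H) ->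
  {in U &, forall a b, [~ a, b] \in H}.
Proof.
move=> defU DH.
pose N := <<[set [~ x.1.1, x.1.2] ^ x.2 | x in setX (setX D D) U]>>%G.
have sNH : N \subset H.
  rewrite gen_subG; apply/subsetP=> _ /imsetP[[[a b] u] /setXP[/setXP[aD bD] uU] ->].
  exact: DH.
have nN : U \subset 'N(N).
  rewrite norms_gen //; apply/subsetP=> u uU; rewrite inE; apply/subsetP=> x.
  rewrite mem_conjg => /imsetP[[[a b] v] /setXP[/setXP[aD bD] vU] e].
  apply/imsetP; exists ((a, b), v * u); first by rewrite !inE /= aD bD groupM.
  by rewrite /= conjgM -e conjgKV.
have DN : D \subset 'N(N) by rewrite (subset_trans (subset_gen D)) // -defU.
suff abUN : abelian (U / N).
  move=> a b aU bU; apply: (subsetP sNH); apply: coset_idr.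
    by rewrite groupR ?(subsetP nN).
  rewrite morphR ?(subsetP nN) //; apply/eqP/commgP.
  by apply: (centsP abUN); rewrite mem_quotient.
rewrite defU quotient_gen // abelian_gen; apply/centsP=> _ /morphimP[a aN aD ->] _ /morphimP[b bN bD ->].
apply/commgP; rewrite -morphR //=; apply/eqP/coset_id/mem_gen/imsetP.
by exists ((a, b), 1); rewrite ?inE /= ?aD ?bD ?group1 ?conjg1.
Qed.

(** On an abelian E the map h |-> [h, z] is an endomorphism, so its values already form a group. An
    element chosen in [E, y^k] is therefore a single commutator [h, y^k], the shape that the norm
    elimination needs. *)
Lemma commutator_image_group (E : {group gT}) (z : gT) : abelian E -> z \in 'N(E) ->
  exists I : {group gT}, I \subset E /\
    forall x, x \in I <-> exists2 h, h \in E & x = [~ h, z].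
Proof.
move=> abE zN.
have cE h : h \in E -> [~ h, z] \in E by move=> hE; rewrite groupM ?groupV ?memJ_norm.
have gI : group_set [set [~ h, z] | h in E].
  apply/group_setP; split; first by apply/imsetP; exists 1; rewrite ?group1 ?comm1g.
  move=> _ _ /imsetP[a aE ->] /imsetP[b bE ->]; apply/imsetP; exists (a * b).
    exact: groupM.
  rewrite commMgJ; congr (_ * _); rewrite conjgE (centsP abE _ (cE a aE) b) //.
  by rewrite mulKg.
exists (Group gI); split=> [|x]; last first.
  by split=> [/imsetP|[h hE ->]] //; exact: imset_f.
by apply/subsetP=> _ /imsetP[h hE ->]; exact: cE.
Qed.

Lemma abelem_gen_class (E : {group gT}) (D : {set gT}) p : prime p -> abelian E ->
  E :=: <<D>> -> {in D, forall x, x ^+ p = 1} -> p.-abelem E.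
Proof.
move=> p_pr abE defE Dp; apply/(abelemP p_pr); split => // x xE.
have gP : group_set [set x in E | x ^+ p == 1].
  apply/group_setP; split; first by rewrite inE group1 expg1n /=.
  move=> a b; rewrite !inE => /andP[aE /eqP ap] /andP[bE /eqP bp].
  by rewrite groupM //= expgMn ?ap ?bp ?mulg1 //; exact: (centsP abE).
suff /subsetP/(_ x xE) : E \subset Group gP by rewrite inE => /andP[_ /eqP].
rewrite {1}defE gen_subG; apply/subsetP=> d dD.
by rewrite inE Dp ?eqxx // andbT defE mem_gen.
Qed.

Import FiniteModule.

(** The norm of b is the correction when y is replaced by y b; if both have n-th power 1, it
    vanishes. This is the source of the norm relation. *)
Lemma expgM_fmod (A : {group gT}) (abA : abelian A) (y b : gT) n :
    y \in 'N(A) -> b \in A ->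
  (y * b) ^+ n = y ^+ n * val (\sum_(i < n) (actr (fmod abA b) (y ^+ i)%g))%R.
Proof.
move=> yN bA; elim: n => [|n IHn]; first by rewrite big_ord0 !expg0 mul1g.
rewrite expgSr IHn big_ord_recl /= expg0 actr1 addrC.
have -> : (\sum_(i < n) actr (fmod abA b) (y ^+ bump 0 i)%g =
   actr (\sum_(i < n) actr (fmod abA b) (y ^+ i)%g) y)%R.
  rewrite actr_sum; apply: eq_bigr => i _.
  by rewrite -actrM ?groupX // -expgSr.
rewrite fmvalA fmvalJ // fmodK //.
rewrite expgSr -!mulgA; congr (_ * _); rewrite !mulgA. by rewrite mulgV mul1g.
Qed.

End MoreFinite.

(** * Numerical estimates *)

Lemma spanning_count (p n L S e : nat) : prime p ->
    S * p ^ (L * n) <= (p ^ n - p.-1 ^ n) ^ L * e ->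
  S * (2 ^ n) ^ L <= (2 ^ n - 1) ^ L * e.
Proof.
move=> p_pr le; have p_gt1 := prime_gt1 p_pr.
(* This rests on p <= 2 (p - 1). The prime p varies with w, so the proportion has to be bounded
   independently of p. *)
have le1 : 2 ^ n * (p ^ n - p.-1 ^ n) <= (2 ^ n - 1) * p ^ n.
  have h : p ^ n <= 2 ^ n * p.-1 ^ n.
    by rewrite -expnMn; case: (posnP n) => [->|n0] //; rewrite leq_exp2r //; lia.
  have h2 : p.-1 ^ n <= p ^ n.
    by case: (posnP n) => [->|n0] //; rewrite leq_exp2r //; lia.
  rewrite mulnBr mulnBl mul1n; exact: leq_sub2l.
have pL : 0 < p ^ (L * n) by rewrite expn_gt0; lia.
rewrite -(leq_pmul2r pL) mulnAC.
apply: (leq_trans (leq_mul le (leqnn _))).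
rewrite -mulnA [e * _]mulnC mulnA -expnMn [(_ - _) * 2 ^ n]mulnC.
rewrite [(2 ^ n - 1) ^ L * e * _]mulnAC leq_mul2r; apply/orP; right.
rewrite [L * n]mulnC expnM -expnMn.
by case: (posnP L) => [->|L0] //; rewrite leq_exp2r.
Qed.

(** Bernoulli's inequality for half of the exponent, squared, gives (q / (q - 1)) ^ L quadratic
    growth in L. *)
Lemma exp_beats_linear (C q : nat) : 1 < q ->
  exists L0, forall L, L0 <= L -> C * L.+1 * (q - 1) ^ L < q ^ L.
Proof.
case: q => [|[|r]] // _; rewrite subn1 /=.
set s := r.+1.
have bern k : s ^ k * (s + k) <= s.+1 ^ k * s.
  elim: k => [|k IHk]; first by rewrite addn0.
  rewrite [s.+1 ^ _]expnS [s ^ _]expnS; move: (s ^ k) (s.+1 ^ k) IHk => a b IHk.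
  apply: (@leq_trans (s.+1 * (a * (s + k)))); last by rewrite -mulnA leq_mul2l IHk orbT.
  have h : s * (s + k.+1) <= s.+1 * (s + k) by nia.
  have := leq_mul (leqnn a) h; nia.
(* This makes k at least 4 (C + 1) s^3: two factors s come from the squared inequality, the third
   pays for odd L. *)
exists (8 * (C.+1 * s * s * s)).+2 => L leL.
pose k := L./2.
have kL : L <= k.*2.+1 by rewrite /k; lia.
have kk : k.*2 <= L by rewrite /k; lia.
have lek : 4 * (C.+1 * s * s * s) <= k by rewrite /k; lia.
have b2 : s ^ k.*2 * ((s + k) * (s + k)) <= s.+1 ^ k.*2 * (s * s).
  by rewrite -addnn !expnD mulnACA [X in _ <= X]mulnACA leq_mul ?bern.
have s0 : 0 < s by [].
have sk : 0 < s ^ k.*2 by rewrite expn_gt0.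
have main : C * k.*2.+2 * s * (s * s) < (s + k) * (s + k).
  move: lek; have -> : C.+1 * s * s * s = C.+1 * (s * (s * s)) by rewrite !mulnA.
  set t := s * (s * s) => lek.
  have t0 : 0 < t by rewrite !muln_gt0.
  have -> : C * k.*2.+2 * s * (s * s) = C * t * k.*2.+2 by rewrite -mulnA mulnAC.
  have k0 : 0 < k by nia.
  apply: (@leq_trans (4 * (C.+1 * t) * k)); first by nia.
  by apply: leq_trans (leq_mul lek (leqnn k)) _; nia.
have main2 : C * k.*2.+2 * s * s ^ k.*2 < s.+1 ^ k.*2.
  have ss0 : 0 < s * s by [].
  rewrite -(ltn_pmul2r ss0); apply: leq_trans b2.
  rewrite -mulnA [s ^ k.*2 * (s * s)]mulnC mulnA [X in _ <= X]mulnC.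
  by rewrite ltn_pmul2r.
have [e|e] : L = k.*2 \/ L = k.*2.+1 by rewrite /k; lia.
  rewrite e; apply: leq_ltn_trans main2; rewrite leq_mul2r; apply/orP; right; nia.
rewrite e [s ^ _]expnS [s.+1 ^ _]expnS mulnA.
apply: (@leq_ltn_trans (C * k.*2.+2 * s * s ^ k.*2)); first by [].
by apply: leq_trans main2 _; rewrite leq_pmull.
Qed.

From mathcomp Require Import all_classical all_reals all_analysis.
From mathcomp Require Import Rstruct Rstruct_topology.
Local Open Scope classical_set_scope.

(** * Groups and their finite quotients *)

Section RawGroup.
Variables (T : choiceType) (mul : T -> T -> T) (inv : T -> T) (one : T).
Hypothesis gA : group_axioms mul inv one.
Local Notation "x ** y" := (mul x y) (at level 40, left associativity).
Local Notation subgroup := (subgroup mul inv one).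
Local Notation gen := (gen mul inv one).
Implicit Types (x y z : T) (H K X S : set T).

Definition gconj x g := inv g ** x ** g.

Lemma gmulA x y z : x ** (y ** z) = x ** y ** z. Proof. by case: gA. Qed.
Lemma gmul1x x : one ** x = x. Proof. by case: gA. Qed.
Lemma gmulx1 x : x ** one = x. Proof. by case: gA. Qed.
Lemma gmulVx x : inv x ** x = one. Proof. by case: gA. Qed.
Lemma gmulxV x : x ** inv x = one. Proof. by case: gA. Qed.
Lemma gmulKx x y : inv x ** (x ** y) = y. Proof. by rewrite gmulA gmulVx gmul1x. Qed.
Lemma gmulVK x y : x ** (inv x ** y) = y. Proof. by rewrite gmulA gmulxV gmul1x. Qed.
Lemma gmulxK x y : y ** x ** inv x = y. Proof. by rewrite -gmulA gmulxV gmulx1. Qed.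
Lemma gmulxVK x y : y ** inv x ** x = y. Proof. by rewrite -gmulA gmulVx gmulx1. Qed.
Lemma ginv_uniq x y : x ** y = one -> y = inv x.
Proof. by move=> e; rewrite -[y](gmulKx x) e gmulx1. Qed.
Lemma ginvK x : inv (inv x) = x. Proof. by rewrite -(ginv_uniq (gmulVx x)). Qed.
Lemma ginvM x y : inv (x ** y) = inv y ** inv x.
Proof. by apply/esym/ginv_uniq; rewrite gmulA gmulxK gmulxV. Qed.
Lemma ginv1 : inv one = one. Proof. by rewrite -(ginv_uniq (gmul1x one)). Qed.
Lemma gconjM x y g : gconj (x ** y) g = gconj x g ** gconj y g.
Proof. by rewrite /gconj !gmulA gmulxK. Qed.
Lemma gconjV x g : gconj (inv x) g = inv (gconj x g).
Proof. by rewrite /gconj !ginvM ginvK gmulA. Qed.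
Lemma gconj_mul x g h : gconj x (g ** h) = gconj (gconj x g) h.
Proof. by rewrite /gconj ginvM !gmulA. Qed.
Lemma gconj1x g : gconj one g = one. Proof. by rewrite /gconj gmulx1 gmulVx. Qed.
Lemma gconjx1 x : gconj x one = x. Proof. by rewrite /gconj gmulx1 ginv1 gmul1x. Qed.
Lemma gconjK x g : gconj (gconj x g) (inv g) = x.
Proof. by rewrite -gconj_mul gmulxV gconjx1. Qed.

Lemma subgroup1 H : subgroup H -> H one. Proof. by case. Qed.
Lemma subgroupM H x y : subgroup H -> H x -> H y -> H (x ** y). Proof. by case=> _ h _; exact: h. Qed.
Lemma subgroupV H x : subgroup H -> H x -> H (inv x). Proof. by case=> _ _; exact. Qed.

Lemma gen_subgroup S : subgroup (gen S).
Proof.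
split=> [H sH _|x y Sx Sy H sH SH|x Sx H sH SH]; first exact: subgroup1.
  by apply: subgroupM => //; [exact: Sx|exact: Sy].
by apply: subgroupV => //; exact: Sx.
Qed.

Lemma gen_incl S : S `<=` gen S.
Proof. by move=> x Sx H _; exact. Qed.

Lemma gen_min S H : subgroup H -> S `<=` H -> gen S `<=` H.
Proof. by move=> sH SH x; exact. Qed.

Lemma subgroupI H K : subgroup H -> subgroup K -> subgroup (H `&` K).
Proof.
move=> sH sK; split=> [|x y [? ?] [? ?]|x [? ?]]; split;
  by [exact: subgroup1|exact: subgroupM|exact: subgroupV].
Qed.

(** A quotient is presented by a map onto a [finGroupType], so that counting and generation can be
    settled by finite group theory. *)
Definition fquot X (Q : finGroupType) (pi : T -> Q) : Prop :=
  [/\ forall x y, pi (x ** y) = (pi x * pi y)%g, forall q, exists x, pi x = q &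
      forall x, X x <-> pi x = 1%g].

Section Quot.
Variables (X : set T) (Q : finGroupType) (pi : T -> Q).
Hypothesis qX : fquot X pi.
Lemma fquotM x y : pi (x ** y) = (pi x * pi y)%g. Proof. by case: qX. Qed.
Lemma fquot_surj q : exists x, pi x = q. Proof. by case: qX. Qed.
Lemma fquotP x : X x <-> pi x = 1%g. Proof. by case: qX. Qed.
Lemma fquot1 : pi one = 1%g.
Proof. by apply: (mulgI (pi one)); rewrite -fquotM gmul1x mulg1. Qed.
Lemma fquotV x : pi (inv x) = (pi x)^-1%g.
Proof. by apply: (mulgI (pi x)); rewrite -fquotM gmulxV fquot1 mulgV. Qed.
Lemma fquotJ x g : pi (gconj x g) = (pi x ^ pi g)%g.
Proof. by rewrite /gconj !fquotM fquotV conjgE mulgA. Qed.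
Lemma fquot_eq x y : pi x = pi y <-> X (inv x ** y).
Proof.
rewrite fquotP fquotM fquotV; split=> [->|]; first by rewrite mulVg.
by move=> e; rewrite -[pi y](mulKVg (pi x)) e mulg1.
Qed.

Lemma index_in_fquot : index_in mul inv [set: T] X #|Q|.
Proof.
pose f (i : 'I_#|Q|) : T := projT1 (cid (fquot_surj (enum_val i))).
have fE i : pi (f i) = enum_val i by rewrite /f; case: cid.
exists f; split=> // x _; exists (enum_rank (pi x)); split.
  by apply/fquot_eq; rewrite fE enum_rankK.
by move=> i /fquot_eq <-; rewrite fE enum_valK.
Qed.

End Quot.

Lemma fquot_exists X n : normal_in mul inv one [set: T] X ->
    index_in mul inv [set: T] X n ->
  exists (Q : finGroupType) (pi : T -> Q), fquot X pi.
Proof.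
move=> [sX _ nX] [f [_ fP]].
pose idx x : 'I_n := projT1 (cid (fP x I)).
have idxP x : X (inv (f (idx x)) ** x) by rewrite /idx; case: cid => i [].
have idxE x i : X (inv (f i) ** x) -> idx x = i.
  by rewrite /idx; case: cid => j /= [_ h] /h.
have nX' x g : X x -> X (gconj x g) by move=> Xx; apply: nX.
have congX x y : X (inv x ** y) -> idx x = idx y.
  move=> Xxy; apply/esym/idxE; have -> : inv (f (idx x)) ** y = inv (f (idx x)) ** x ** (inv x ** y).
    by rewrite -gmulA gmulVK.
  by apply: subgroupM => //; exact: idxP.
have idxK x : X (inv x ** f (idx x)).
  by have := subgroupV sX (idxP x); rewrite ginvM ginvK.
have idxf i : idx (f i) = i by apply: idxE; rewrite gmulVx; exact: subgroup1.
have mul_r x y z : X (inv y ** z) -> idx (x ** y) = idx (x ** z).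
  by move=> h; apply: congX; rewrite ginvM -gmulA gmulKx.
have mul_l x y z : X (inv y ** z) -> idx (y ** x) = idx (z ** x).
  move=> h; apply: congX; rewrite ginvM -gmulA [inv y ** _]gmulA gmulA.
  exact: (nX' _ x h).
(* The quotient group lives on the numbers of the cosets, multiplied through their
   representatives. *)
pose op i j : 'I_n := idx (f i ** f j).
pose e : 'I_n := idx one.
pose iv i : 'I_n := idx (inv (f i)).
have opA : associative op.
  move=> i j k; rewrite /op.
  rewrite -(mul_r (f i) (f j ** f k) (f (idx (f j ** f k)))) //.
  by rewrite -(mul_l (f k) (f i ** f j) (f (idx (f i ** f j)))) ?gmulA.
have op1 : left_id e op.
  by move=> i; rewrite /op /e -(mul_l (f i) one (f (idx one))) ?gmul1x ?idxf.
have opV : left_inverse e iv op.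
  by move=> i; rewrite /op /iv -(mul_l (f i) (inv (f i)) (f (idx (inv (f i))))) ?gmulVx.
pose Q : finGroupType := HB.pack 'I_n (Finite_isGroup.Build 'I_n opA op1 opV).
exists Q, idx; split=> [x y|q|x].
- rewrite -[RHS]/(op (idx x) (idx y)) /op.
  by rewrite -(mul_l (f (idx y)) x (f (idx x))) // -(mul_r x y (f (idx y))).
- by exists (f q); exact: idxf.
rewrite -[X in _ = X]/e /e; split=> [Xx|e1].
  by apply/esym/congX; rewrite ginv1 gmul1x.
have := idxP x; rewrite e1 => h.
have := subgroupM sX (idxK one) h; rewrite ginv1 gmul1x gmulVK //.
Qed.

(** The list may meet a coset several times; keeping the first representative of each coset turns
    the cover into a transversal. *)
Lemma cover_finite_index K H (l : seq T) : subgroup H ->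
    (forall x, x \in l -> K x) ->
    (forall x, K x -> exists2 d, d \in l & H (inv d ** x)) ->
  finite_index mul inv K H.
Proof.
move=> sH lK cov.
pose canon x := nth one l (find (fun d => `[< H (inv d ** x) >]) l).
have canonP x : K x -> canon x \in l /\ H (inv (canon x) ** x).
  move=> /cov[d dl Hd]; have hl : has (fun d => `[< H (inv d ** x) >]) l.
    by apply/hasP; exists d => //; apply/asboolP.
  split; first by rewrite mem_nth // -has_find.
  exact/asboolP/(nth_find one hl).
have canonE x y : H (inv x ** y) -> canon x = canon y.
  move=> Hxy; congr nth; apply: eq_find => d; apply: asbool_equiv_eq; split=> h.
    by have := subgroupM sH h Hxy; rewrite -gmulA gmulVK.
  by have := subgroupM sH h (subgroupV sH Hxy); rewrite ginvM ginvK -gmulA gmulVK.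
pose l' := undup [seq canon d | d <- l].
have l'P d : d \in l' -> canon d = d.
  rewrite mem_undup => /mapP[c cl ->].
  exact: canonE (canonP c (lK c cl)).2.
exists (size l'), (nth one l'); split=> [i|x Kx].
  have : nth one l' i \in l' by rewrite mem_nth.
  by rewrite mem_undup => /mapP[c /lK/canonP[+ _] ->]; exact: lK.
have xl' : canon x \in l'.
  have [d dl Hd] := cov x Kx.
  by rewrite mem_undup -(canonE _ _ Hd); exact: map_f.
have il : (index (canon x) l' < size l')%N by rewrite index_mem.
exists (Ordinal il); split=> [|i Hi] /=.
  by rewrite nth_index //; exact: (canonP x Kx).2.
apply: val_inj => /=; rewrite -(canonE _ _ Hi) l'P ?mem_nth //.
by rewrite index_uniq ?undup_uniq.
Qed.

End RawGroup.

(** * Schreier generators and normal closures *)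

Section Generation.
Variables (T : choiceType) (mul : T -> T -> T) (inv : T -> T) (one : T).
Hypothesis gA : group_axioms mul inv one.
Local Notation "x ** y" := (mul x y) (at level 40, left associativity).
Local Notation subgroup := (subgroup mul inv one).
Local Notation gen := (gen mul inv one).
Local Notation gconj := (gconj mul inv).
Local Notation gmulA := (gmulA gA).
Implicit Types (x y z : T) (G H K X S : set T) (l : seq T).

Lemma schreier G (l : seq T) H m : G = gen [set` l] -> subgroup H -> H `<=` G ->
    index_in mul inv G H m ->
  exists2 l' : seq T, size l' = (size l * m)%N & H = gen [set` l'].
Proof.
move=> defG sH HG [f0 [f0G f0P]].
have sG : subgroup G by rewrite defG; exact: gen_subgroup.
have [i0 [Hi0 _]] := f0P one (subgroup1 sG).
rewrite (gmulx1 gA) in Hi0; have Hf0 : H (f0 i0) by rewrite -(ginvK gA (f0 i0)); exact: (subgroupV sH).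
(* Normalised so that H itself is represented by 1; then w h i0 = h for h in H. *)
pose f i := f0 i ** inv (f0 i0).
have fG i : G (f i) by exact: (subgroupM sG (f0G i) (subgroupV sG (f0G i0))).
have fi0 : f i0 = one by exact: (gmulxV gA).
have Hf i x : H (inv (f i) ** x) <-> H (inv (f0 i) ** x).
  rewrite /f (ginvM gA) (ginvK gA) -gmulA; split=> h; last exact: (subgroupM sH Hf0 h).
  by rewrite -(gmulKx gA (f0 i0) (inv (f0 i) ** x)); exact: (subgroupM sH (subgroupV sH Hf0)).
have [i1] : inhabited 'I_m by split; exact: i0.
pose idx x : 'I_m := xget i1 [set i | H (inv (f i) ** x)].
have idxP x : G x -> H (inv (f (idx x)) ** x).
  move=> Gx; have [i [Hi _]] := f0P x Gx.
  by apply: (@xgetPex _ i1 [set i | H (inv (f i) ** x)]); exists i; apply/Hf.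
have idxE x i : G x -> H (inv (f i) ** x) -> idx x = i.
  move=> Gx /Hf Hi; have [j [_ ju]] := f0P x Gx.
  by rewrite -(ju i Hi) -(ju (idx x)) //; apply/Hf/idxP.
pose w x i := inv (f (idx (x ** f i))) ** (x ** f i).
pose l' := [seq w s i | s <- l, i <- enum 'I_m].
exists l'; first by rewrite size_allpairs size_enum_ord.
have lG s : s \in l -> G s by move=> sl; rewrite defG; exact: (gen_incl (S := [set` l]) sl).
have sH' : subgroup (gen [set` l']) := gen_subgroup _ _ _ _.
have H'H : gen [set` l'] `<=` H.
  apply: gen_min => // _ /allpairsP[[s i] /= [sl _ ->]].
  by apply: idxP; apply: (subgroupM sG) => //; exact: lG.
apply/seteqP; split=> // h Hh.
(* Cocycle rule: w (x y) i = w x j ** w y i, where j is the coset of y f_i. It makes [A] a subgroup,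
   and [A] contains the generators of G. *)
pose A := [set x | G x /\ forall i, gen [set` l'] (w x i)].
have wE x i : x ** f i = f (idx (x ** f i)) ** w x i by rewrite /w (gmulVK gA).
suff GA : G `<=` A.
  have [_ /(_ i0)] := GA h (HG _ Hh); rewrite /w fi0 (gmulx1 gA).
  by rewrite (idxE h i0) ?fi0 ?(ginv1 gA) ?(gmul1x gA) //; exact: HG.
rewrite {1}defG; apply: gen_min; last first.
  move=> s sl; split; first exact: lG.
  by move=> i; apply: gen_incl; apply/allpairsP; exists (s, i); rewrite mem_enum.
split=> [|x y [Gx Ax] [Gy Ay]|x [Gx Ax]].
- split=> [|i]; first exact: (subgroup1 sG).
  by rewrite /w (gmul1x gA) (idxE _ i) ?(gmulVx gA) //; [exact: (subgroup1 sH')|exact: (subgroup1 sH)].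
- split=> [|i]; first exact: (subgroupM sG).
  set j := idx (y ** f i); set k := idx (x ** f j).
  have e : x ** y ** f i = f k ** (w x j ** w y i).
    by rewrite -gmulA [y ** _]wE -/j gmulA [x ** f j]wE -/k -gmulA.
  have Hw : gen [set` l'] (w x j ** w y i) by exact: (subgroupM sH').
  rewrite /w (idxE _ k) ?e ?(gmulKx gA) //; last exact: H'H.
  by rewrite -e; apply: (subgroupM sG) => //; exact: (subgroupM sG).
- split=> [|i]; first exact: (subgroupV sG).
  set k := idx (inv x ** f i).
  have e : x ** f k = f i ** inv (w (inv x) i).
    by rewrite /w -/k (ginvM gA) (ginvK gA) (ginvM gA (inv x)) (ginvK gA x) -gmulA (gmulVK gA).
  have Gk : G (inv x ** f i) by apply: (subgroupM sG) => //; exact: (subgroupV sG).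
  have wk : w x k = inv (w (inv x) i).
    rewrite {1}/w (idxE _ i) ?e ?(gmulKx gA) //; first by rewrite -e; exact: (subgroupM sG).
    by apply: (subgroupV sH); exact: idxP.
  by rewrite -(ginvK gA (w _ _)) -wk; exact: (subgroupV sH').
Qed.

Lemma gen_finite S x : gen S x ->
  exists2 l : seq T, (forall s, s \in l -> S s) & gen [set` l] x.
Proof.
pose A := [set x | exists2 l : seq T, (forall s, s \in l -> S s) & gen [set` l] x].
move=> Sx; suff : A x by []; apply: Sx.
  split=> [|y z [ly lyS gy] [lz lzS gz]|y [l lS gy]].
  - by exists [::] => //; exact: (subgroup1 (gen_subgroup _ _ _ _)).
  - exists (ly ++ lz) => [s|]; first by rewrite mem_cat => /orP[/lyS|/lzS].
    apply: (subgroupM (gen_subgroup _ _ _ _)).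
      by apply: (gen_min _ _ gy); [exact: gen_subgroup|move=> s /= sl; apply: gen_incl; rewrite /= mem_cat sl].
    by apply: (gen_min _ _ gz); [exact: gen_subgroup|move=> s /= sl; apply: gen_incl; rewrite /= mem_cat sl orbT].
  - by exists l => //; exact: (subgroupV (gen_subgroup _ _ _ _)).
move=> s Ss; exists [:: s] => [t|]; first by rewrite inE => /eqP ->.
by apply: gen_incl; rewrite /= inE.
Qed.

(** Each element of the list involves finitely many elements of S. Applied to normal closures: of
    finite index, hence finitely generated, hence generated by finitely many conjugates. *)
Lemma gen_finite_list S (l : seq T) : gen S = gen [set` l] ->
  exists2 l' : seq T, (forall s, s \in l' -> S s) & gen S = gen [set` l'].
Proof.
move=> e; suff [l' l'S ll'] : exists2 l' : seq T, (forall s, s \in l' -> S s) &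
    forall x, x \in l -> gen [set` l'] x.
  exists l' => //; apply/seteqP; split.
    by rewrite e; apply: gen_min; [exact: gen_subgroup|exact: ll'].
  by apply: gen_min; [exact: gen_subgroup|move=> s /l'S Ss; exact: (gen_incl Ss)].
have : forall x, x \in l -> gen S x by move=> x xl; rewrite e; exact: (@gen_incl _ _ _ _ [set` l]).
elim: l {e} => [_|x l IHl lS]; first by exists [::].
have [|l1 l1S Hl1] := IHl; first by move=> y yl; apply: lS; rewrite inE yl orbT.
have [l2 l2S gx] := gen_finite (lS x (mem_head _ _)).
exists (l1 ++ l2) => [s|y]; first by rewrite mem_cat => /orP[/l1S|/l2S].
have mono l3 : {subset l3 <= l1 ++ l2} -> gen [set` l3] `<=` gen [set` l1 ++ l2].
  by move=> sl; apply: gen_min; [exact: gen_subgroup|move=> s /sl; exact: (@gen_incl _ _ _ _ [set` l1 ++ l2])].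
rewrite inE => /predU1P[->|yl].
  by apply: (mono l2) gx => s sl; rewrite mem_cat sl orbT.
by apply: (mono l1) (Hl1 y yl) => s sl; rewrite mem_cat sl.
Qed.

Definition normal_gen G x := gen [set gconj x g | g in G].

Lemma normal_gen_normal G x : subgroup G -> G x -> normal_in mul inv one G (normal_gen G x).
Proof.
move=> sG Gx; split; first exact: gen_subgroup.
  by apply: gen_min => // _ [g Gg <-]; apply: (subgroupM sG) => //; apply: (subgroupM sG) => //; exact: (subgroupV sG).
move=> k h Gk nh; suff : normal_gen G x `<=` [set z | normal_gen G x (gconj z k)] by exact.
have sn : subgroup (normal_gen G x) by exact: gen_subgroup.
apply: gen_min.
  split=> [|y z|y] /=; first by rewrite (gconj1x gA); exact: (subgroup1 sn).
    by rewrite (gconjM gA) => hy hz; exact: (subgroupM sn).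
  by rewrite (gconjV gA) => hy; exact: (subgroupV sn).
move=> _ [g Gg <-]; rewrite /= -(gconj_mul gA); apply: gen_incl.
by exists (g ** k) => //; exact: (subgroupM sG).
Qed.

Lemma mem_normal_gen G x : subgroup G -> normal_gen G x x.
Proof. by move=> sG; apply: gen_incl; exists one; [exact: (subgroup1 sG)|exact: (gconjx1 gA)]. Qed.

Lemma comm_sub_normal U : normal_in mul inv one [set: T] U ->
  normal_in mul inv one [set: T] (comm_sub mul inv one U).
Proof.
move=> [sU _ nU]; split=> //; first exact: gen_subgroup.
have sC : subgroup (comm_sub mul inv one U) by exact: gen_subgroup.
move=> k h _ Ch; suff : comm_sub mul inv one U `<=` [set z | comm_sub mul inv one U (gconj z k)] by exact.
apply: gen_min.
  split=> [|y z|y] /=; first by rewrite (gconj1x gA); exact: (subgroup1 sC).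
    by rewrite (gconjM gA) => hy hz; exact: (subgroupM sC).
  by rewrite (gconjV gA) => hy; exact: (subgroupV sC).
move=> _ [a Ua [b Ub <-]] /=; apply: gen_incl; exists (gconj a k); first exact: nU.
by exists (gconj b k); [exact: nU|rewrite !(gconjM gA) !(gconjV gA)].
Qed.

Lemma comm_sub_sub U : subgroup U -> comm_sub mul inv one U `<=` U.
Proof.
move=> sU; apply: gen_min => // _ [a Ua [b Ub <-]].
by apply: (subgroupM sU); apply: (subgroupM sU) => //; exact: (subgroupV sU).
Qed.

End Generation.

(** * Profinite groups *)

(** Compactness of the complement of O: each of its points is missed by some clopen neighbourhood of
    x, and these neighbourhoods are stable under intersection. *)
Lemma compact_clopen_nbhd (T : topologicalType) (x : T) (O : set T) :
    compact [set: T] -> open O ->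
    (forall y, (forall K, clopen K -> K x -> K y) -> O y) ->
  exists K, [/\ clopen K, K x & K `<=` O].
Proof.
move=> cT oO HO.
pose F := filter_from [set D : set T | D x /\ clopen D] id.
have FF : Filter F.
  apply: filter_from_filter; first by exists setT; split => //; exact: clopenT.
  by move=> A B [? ?] [? ?]; exists (A `&` B) => //; split=> //; exact: clopenI.
have PF : ProperFilter F by apply: filter_from_proper; move=> ? [? _]; exists x.
have /(iffLR (compact_near_coveringP _)) : compact (~` O).
  by apply: (subclosed_compact _ cT) => //; exact: open_closedC.
move=> /(_ _ _ setC (powerset_filter_from_filter PF))[].
  move=> y nOy.
  have [C [[oC cC] Cx nCy]] : exists C, [/\ clopen C, C x & ~ C y].
    apply: contrapT => nC; apply: nOy; apply: HO => K clK Kx.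
    by apply: contrapT => nKy; apply: nC; exists K.
  exists (~` C, [set U | U `<=` C]); first split.
  - by apply: open_nbhs_nbhs; split => //; exact: closed_openC.
  - apply/near_powerset_filter_fromP; first by move=> ? ?; exact: subset_trans.
    by exists C => //; exists C.
  - by case=> i j [? /subsetC]; apply.
move=> D [DF _ [C DC]]/(_ _ DC)/subsetC2 CO.
have [K [Kx clK] KC] := DF _ DC.
by exists K; split => //; exact: subset_trans KC CO.
Qed.

(** The quasi-component Q of x is connected: the pieces of a separation have disjoint open
    neighbourhoods, some clopen K around x lies in their union, and they cut K into clopen parts,
    one of which contains x and therefore Q. *)
Lemma compact_totally_disconnected_zero_dimensional (T : topologicalType) :
  compact [set: T] -> hausdorff_space T -> totally_disconnected [set: T] ->
  zero_dimensional T.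
Proof.
move=> cT hT tdT x y xy.
apply: contrapT => nsep.
pose Q := [set z | forall K, clopen K -> K x -> K z].
have Qx : Q x by [].
have Qy : Q y.
  by move=> K clK Kx; apply: contrapT => nKy; apply: nsep; exists K.
have clQ : closed Q.
  have -> : Q = \bigcap_(K in [set K | clopen K /\ K x]) K.
    by apply/seteqP; split=> [z Qz K [clK Kx]|z Iz K clK Kx]; [exact: Qz|exact: Iz].
  by apply: closed_bigI => K [[]].
suff cQ : connected Q.
  have yx : connected_component [set: T] x y by exists Q.
  by rewrite tdT //= in yx; rewrite yx eqxx in xy.
move=> B B0 [D oD BD] [C cC BC].
have clB : closed B by rewrite BC; exact: closedI.
have clB' : closed (Q `&` ~` D) by apply: closedI => //; exact: open_closedC.
have BB' : B `&` (Q `&` ~` D) = set0 by rewrite BD -subset0 => z [[_ Dz] [_]].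
have [U [W [oU oW BU BW UW0]]] := (@normal_openP Rdefinitions.R T).1
  (compact_normal hT cT) _ _ clB clB' BB'.
have QUW z : Q z -> U z \/ W z.
  move=> Qz; have [Dz|nDz] := pselect (D z); first by left; apply: BU; rewrite BD.
  by right; apply: BW.
have [K [[oK cK] Kx KUW]] := compact_clopen_nbhd cT (openU oU oW) QUW.
have dis z : U z -> W z -> False by move=> Uz Wz; have : (U `&` W) z by []; rewrite UW0.
have clop (U' W' : set T) : open U' -> open W' -> (forall z, K z -> U' z \/ W' z) ->
    (forall z, U' z -> W' z -> False) -> clopen (K `&` U').
  move=> oU' oW' KUW' dis'; split; first exact: openI.
  have -> : K `&` U' = K `&` ~` W'.
    apply/seteqP; split=> z [Kz Hz]; split => //; first by move=> Wz; exact: dis' Hz Wz.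
    by have [//|Wz] := KUW' z Kz; case: Hz.
  by apply: closedI => //; exact: open_closedC.
have [Ux|Wx] := KUW x Kx.
  rewrite eqEsubset BD; split=> z; first by case.
  move=> Qz; split=> //; apply: contrapT => nDz.
  have [_ Uz] := Qz _ (clop U W oU oW KUW dis) (conj Kx Ux).
  by apply: (dis z) => //; apply: BW.
have [z Bz] := B0.
have Qz : Q z by move: Bz; rewrite BD => -[].
have [_ Wz] := Qz _ (clop W U oW oU (fun z Kz => (or_comm _ _).1 (KUW z Kz)) (fun z a b => dis z b a)) (conj Kx Wx).
by exfalso; apply: (dis z) => //; exact: BU.
Qed.

(** * Open normal subgroups and finite quotients *)

Section Profinite.
Variables (T : topologicalType) (mul : T -> T -> T) (inv : T -> T) (one : T).
Hypothesis PG : profinite_group mul inv one.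
Local Notation "x ** y" := (mul x y) (at level 40, left associativity).
Local Notation subgroup := (subgroup mul inv one).
Local Notation gen := (gen mul inv one).
Local Notation gconj := (gconj mul inv).
Local Notation open_normal := (open_normal mul inv one).
Local Notation comm_sub := (comm_sub mul inv one).
Local Notation fquot := (fquot mul).
Implicit Types (x y z : T) (H K X U V S : set T) (l : seq T).

Lemma profinite_groupA : group_axioms mul inv one.
Proof. by case: PG => -[]. Qed.
Local Notation gmulA := (gmulA profinite_groupA).

Lemma continuous_mull a : continuous (fun x => a ** x).
Proof.
case: PG => -[_ cm _] _ _ _ x; have cx := cm (a, x).
apply: (@continuous2_cvg T T T T (nbhs x) _ (fun=> a) id mul a x) => //; exact: cvg_cst.
Qed.

Lemma continuous_mulr a : continuous (fun x => x ** a).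
Proof.
case: PG => -[_ cm _] _ _ _ x; have cx := cm (x, a).
apply: (@continuous2_cvg T T T T (nbhs x) _ id (fun=> a) mul x a) => //; exact: cvg_cst.
Qed.

Lemma continuous_gconj g : continuous (fun x => gconj x g).
Proof.
move=> x; apply: (@continuous_comp _ _ _ (fun x => inv g ** x) (fun x => x ** g)).
  exact: continuous_mull.
exact: continuous_mulr.
Qed.

Lemma continuous_gconjr x : continuous (fun g => gconj x g).
Proof.
case: PG => -[_ cm ci] _ _ _ g.
have cg : {for inv g ** x, continuous (fun y => y ** g)} by exact: continuous_mulr.
apply: (@continuous2_cvg T T T T (nbhs g) _ (fun g => inv g ** x) id mul (inv g ** x) g).
- exact: (cm (_, _)).
- apply: (@continuous_comp _ _ _ inv (fun y => y ** x)); first exact: ci.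
  exact: continuous_mulr.
- exact: cvg_id.
Qed.

Lemma open_translate X a : open X -> open [set x | X (inv a ** x)].
Proof.
by move=> oX; apply: (@open_comp _ _ (fun x => inv a ** x)) => // x _; exact: continuous_mull.
Qed.

Lemma closed_translate X a : closed X -> closed [set x | X (inv a ** x)].
Proof.
by move=> cX; apply: (@preimage_closed _ _ (fun x => inv a ** x)) => // x _; exact: continuous_mull.
Qed.

Lemma open_subgroup_closed X : open X -> subgroup X -> closed X.
Proof.
move=> oX sX x clx.
have [y [Xy]] := clx [set y | X (inv x ** y)]
  (open_nbhs_nbhs (conj (open_translate x oX) (eq_ind_r X (subgroup1 sX) (gmulVx profinite_groupA x)))).
move=> /= h; have := subgroupM sX Xy (subgroupV sX h).
by rewrite (ginvM profinite_groupA) (ginvK profinite_groupA) (gmulVK profinite_groupA).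
Qed.

Lemma nbhs_subgroup_open X : nbhs one X -> subgroup X -> open X.
Proof.
move=> nX sX; rewrite openE => x Xx.
have nX' : nbhs x [set y | X (inv x ** y)].
  by apply: (continuous_mull (a := inv x)); rewrite (gmulVx profinite_groupA).
apply: (filterS _ nX') => y /= h.
by rewrite -(gmulVK profinite_groupA x y); exact: (subgroupM sX Xx h).
Qed.

Lemma open_normal_basis W : nbhs one W -> exists2 X, open_normal X & X `<=` W.
Proof.
case: PG => -[_ cm ci] cT hT tdT nW.
have zT := compact_totally_disconnected_zero_dimensional cT hT tdT.
have [K [K1 [oK cK]] KW] := zero_dimensional_cvg hT zT cT nW.
have compK : compact K by exact: subclosed_compact cK cT _.
have nK : \forall w \near one, K `<=` [set k | K (k ** w)].
  apply: (compact_near_coveringP K).1 => // x Kx.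
  have := cm (x, one) K; rewrite /= (gmulx1 profinite_groupA) => /(_ (open_nbhs_nbhs (conj oK Kx))).
  by [].
(* The right stabiliser of the clopen set K is open by a tube argument over the compact K; its
   normal core X below is open by the same argument over the whole group. *)
pose H := [set w | (forall k, K k -> K (k ** w)) /\ (forall k, K k -> K (k ** inv w))].
have sH : subgroup H.
  split=> [|x y [Hx Hx'] [Hy Hy']|x [Hx Hx']].
  - by split=> k Kk; rewrite ?(ginv1 profinite_groupA) (gmulx1 profinite_groupA).
  - split=> k Kk; first by rewrite gmulA; apply/Hy/Hx.
    by rewrite (ginvM profinite_groupA) gmulA; apply/Hx'/Hy'.
  - by split=> k Kk; [exact: Hx'|rewrite (ginvK profinite_groupA); exact: Hx].
have nH : nbhs one H.
  have nK' : \forall w \near one, K `<=` [set k | K (k ** inv w)].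
    by have := ci one (fun w => K `<=` [set k | K (k ** w)]); rewrite (ginv1 profinite_groupA); exact.
  by apply: filterS2 nK nK' => w h h'; split.
pose X := [set x | forall g, H (gconj x g)].
have sX : subgroup X.
  split=> [g|x y Xx Xy g|x Xx g]; first by rewrite (gconj1x profinite_groupA); exact: (subgroup1 sH).
    by rewrite (gconjM profinite_groupA); exact: (subgroupM sH).
  by rewrite (gconjV profinite_groupA); exact: (subgroupV sH).
have nX : nbhs one X.
  have : \forall x \near one, [set: T] `<=` [set g | H (gconj x g)].
    apply: (compact_near_coveringP [set: T]).1 => // g _.
    have cj2 : {for (g, one), continuous (fun p : T * T => inv p.1 ** p.2 ** p.1)}.
      apply: (@continuous2_cvg _ T T T (nbhs (g, one)) _ (fun p => inv p.1 ** p.2) fst mul (inv g ** one) g).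
      - exact: (cm (_, _)).
      - apply: (@continuous2_cvg _ T T T (nbhs (g, one)) _ (fun p => inv p.1) snd mul (inv g) one).
        + exact: (cm (_, _)).
        + by apply: (@cvg_comp _ _ _ fst inv _ (nbhs g)); [exact: cvg_fst|exact: ci].
        + exact: cvg_snd.
      - exact: cvg_fst.
    by have := cj2 H; rewrite /= (gmulx1 profinite_groupA) (gmulVx profinite_groupA); apply.
  by apply: filterS => x h g; exact: h.
exists X; last first.
  move=> x Xx; apply: KW; have [h _] := Xx one.
  by have := h one K1; rewrite (gmul1x profinite_groupA) (gconjx1 profinite_groupA).
split; first exact: nbhs_subgroup_open.
by split=> // k h _ Xh g; rewrite -(gconj_mul profinite_groupA); exact: Xh.
Qed.

Lemma open_normalI X Y : open_normal X -> open_normal Y -> open_normal (X `&` Y).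
Proof.
move=> [oX [sX _ nX]] [oY [sY _ nY]]; split; first exact: openI.
split=> //; first exact: subgroupI.
by move=> k h _ [Xh Yh]; split; [exact: nX|exact: nY].
Qed.

Lemma open_normal_sep x : x <> one -> exists2 X, open_normal X & ~ X x.
Proof.
move=> x1; have nx : nbhs one (~` [set x]).
  apply: open_nbhs_nbhs; split; last by move=> /= e; apply: x1.
  by apply: closed_openC; apply: accessible_closed_set1; apply: hausdorff_accessible; case: PG.
by have [X oX XW] := open_normal_basis nx; exists X => // Xx; apply: (XW x Xx).
Qed.

Lemma open_finite_index X : open X -> subgroup X -> finite_index mul inv [set: T] X.
Proof.
move=> oX sX; case: PG => _ cT _ _.
pose pT : ptopologicalType := HB.pack (T : Type) (isPointed.Build T one) T.
have cpT : @cover_compact pT [set: pT] by rewrite -compact_cover.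
have [|x _|D _ DT] := cpT T [set: T] (fun a => [set x | X (inv a ** x)]).
- by move=> a _; exact: open_translate.
- by exists x => //=; rewrite (gmulVx profinite_groupA); exact: (subgroup1 sX).
apply: (@cover_finite_index T mul inv one profinite_groupA _ _ (finmap.enum_fset D)) => //.
Qed.

Lemma open_fquot X : open_normal X -> exists (Q : finGroupType) (pi : T -> Q), fquot X pi.
Proof.
move=> [oX nX]; have [sX _ _] := nX; have [n iX] := open_finite_index oX sX.
exact: (fquot_exists profinite_groupA nX iX).
Qed.

Lemma closed_cover_open H l : closed H -> subgroup H ->
  (forall x, exists2 d, d \in l & H (inv d ** x)) -> open H.
Proof.
move=> cH sH cov; rewrite -closedC.
have -> : ~` H = \bigcup_(d in [set d | d \in [seq d <- l | ~~ `[< H d >]]]) [set x | H (inv d ** x)].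
  apply/seteqP; split=> [x nHx|x [d]].
    have [d dl Hd] := cov x; exists d => //=; rewrite mem_filter dl andbT.
    apply/asboolPn => Hd'; apply: nHx; have := subgroupM sH Hd' Hd.
    by rewrite (gmulVK profinite_groupA).
  rewrite /= mem_filter => /andP[/asboolPn nHd _] Hdx Hx; apply: nHd.
  have := subgroupM sH Hx (subgroupV sH Hdx).
  by rewrite (ginvM profinite_groupA) (ginvK profinite_groupA) (gmulVK profinite_groupA).
apply: closed_bigcup => [|d _]; last exact: closed_translate.
exact: finite_seq.
Qed.

Lemma closure_subgroup H : subgroup H -> subgroup (closure H).
Proof.
case: PG => -[_ cm ci] _ _ _ sH; split=> [|x y clx cly A|x clx A].
- exact/subset_closure/(subgroup1 sH).
- move/(cm (x, y)) => [[A1 A2] /= [nA1 nA2] A12].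
  have [a [Ha A1a]] := clx _ nA1; have [b [Hb A2b]] := cly _ nA2.
  by exists (a ** b); split; [exact: (subgroupM sH)|exact: (A12 (a, b))].
- move/(ci x) => nA; have [a [Ha Aa]] := clx _ nA.
  by exists (inv a); split; [exact: (subgroupV sH)|].
Qed.

Lemma closure_fquot X (Q : finGroupType) (pi : T -> Q) D x :
  open X -> fquot X pi -> closure D x -> exists2 d, D d & pi d = pi x.
Proof.
move=> oX qX clx; have X1 : X one by apply: (fquotP qX one).2; exact: (fquot1 profinite_groupA qX).
have [d [Dd Xd]] := clx [set y | X (inv x ** y)]
  (open_nbhs_nbhs (conj (open_translate x oX) (eq_ind_r X X1 (gmulVx profinite_groupA x)))).
by exists d => //; apply/esym/(fquot_eq profinite_groupA qX).
Qed.

Lemma fquot_gen_lift X (Q : finGroupType) (pi : T -> Q) S (D : {set Q}) q :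
    fquot X pi -> (forall d, d \in D -> exists2 x, S x & pi x = d) ->
  q \in <<D>>%g -> exists2 g, gen S g & pi g = q.
Proof.
move=> qX DS qD; have sS : subgroup (gen S) := gen_subgroup _ _ _ _.
pose P : {set Q} := finset (fun q => `[< exists2 g, gen S g & pi g = q >]).
have gP : group_set P.
  apply/group_setP; split.
    by rewrite inE; apply/asboolP; exists one; [exact: (subgroup1 sS)|exact: (fquot1 profinite_groupA qX)].
  move=> a b; rewrite !finset.in_set => /asboolP[g Sg <-] /asboolP[h Sh <-].
  by apply/asboolP; exists (g ** h); [exact: (subgroupM sS)|exact: (fquotM qX)].
suff /fintype.subsetP sP : (<<D>> \subset Group gP)%g.
  by move: (sP _ qD); rewrite finset.in_set => /asboolP.
rewrite gen_subG; apply/fintype.subsetP=> d /DS[x Sx <-].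
by rewrite finset.in_set; apply/asboolP; exists x => //; exact: (gen_incl Sx).
Qed.

Lemma fquot_gen_sub X (Q : finGroupType) (pi : T -> Q) S (D : {group Q}) g :
    fquot X pi -> (forall x, S x -> pi x \in D) -> gen S g -> pi g \in D.
Proof.
move=> qX SD Sg; suff : [set x | pi x \in D] g by [].
apply: Sg => //; split=> [|x y|x] /=; first by rewrite (fquot1 profinite_groupA qX).
  by rewrite (fquotM qX) => ? ?; rewrite groupM.
by rewrite (fquotV profinite_groupA qX) groupV.
Qed.

Lemma open_normal_prod N X : normal_in mul inv one [set: T] N -> open_normal X ->
  open_normal [set x | exists c x0, [/\ N c, X x0 & x = c ** x0]].
Proof.
move=> [sN _ nN] [oX [sX _ nX]]; set Y := [set x | _].
have XY : X `<=` Y.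
  by move=> x Xx; exists one, x; split => //; [exact: (subgroup1 sN)|rewrite (gmul1x profinite_groupA)].
have sY : subgroup Y.
  split=> [|_ _ [c [x [Nc Xx ->]]] [d [y [Nd Xy ->]]]|_ [c [x [Nc Xx ->]]]].
  - by apply: XY; exact: (subgroup1 sX).
  - exists (c ** d), (gconj x d ** y); split.
    + exact: (subgroupM sN).
    + by apply: (subgroupM sX) => //; exact: nX.
    + by rewrite /gconj !gmulA (gmulxK profinite_groupA).
  - exists (inv c), (gconj (inv x) (inv c)); split.
    + exact: (subgroupV sN).
    + by apply: nX => //; exact: (subgroupV sX).
    + by rewrite (ginvM profinite_groupA) /gconj -gmulA (gmulVK profinite_groupA).
split; first apply: (nbhs_subgroup_open) => //.
  apply: filterS XY _; apply: open_nbhs_nbhs; split => //; exact: (subgroup1 sX).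
split => // k h _ [c [x [Nc Xx ->]]]; exists (gconj c k), (gconj x k).
by split; [exact: nN|exact: nX|exact: (gconjM profinite_groupA)].
Qed.

(** Quotients by [U,U] X0 suffice: an equality modulo this group leaves a factor in [U,U], which is
    allowed among the generators, and one in X0, which is as small as desired. *)
Lemma ab_top_gen_finite_quotients U l : open_normal U -> (forall x, x \in l -> U x) ->
    (forall X (Q : finGroupType) (pi : T -> Q), open_normal X -> comm_sub U `<=` X ->
       X `<=` U -> fquot X pi -> forall u, U u -> pi u \in <<finset (mem [seq pi x | x <- l])>>%g) ->
  ab_top_gen mul inv one U (size l).
Proof.
move=> oU lU Hl; have [opU nU] := oU; have [sU _ _] := nU.
exists (nth one l); split=> [i|]; first exact/lU/mem_nth.
pose R := range (fun i : 'I_(size l) => nth one l i); rewrite -/R.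
have RE x : x \in l -> R x.
  move=> xl; have il : (index x l < size l)%N by rewrite index_mem.
  by exists (Ordinal il) => //=; rewrite nth_index.
have nC := comm_sub_normal profinite_groupA nU; have [sC _ _] := nC.
have sG : subgroup (gen (R `|` comm_sub U)) := gen_subgroup _ _ _ _.
apply/seteqP; split.
  have cU := open_subgroup_closed opU sU.
  move/closure_id: cU => {2}->; apply: closureS; apply: gen_min => // x [[i _ <-]|].
    exact/lU/mem_nth.
  exact: comm_sub_sub.
move=> u Uu A nA.
have nA1 : nbhs one [set x | A (u ** x)].
  by apply: (continuous_mull (a := u)); rewrite (gmulx1 profinite_groupA).
have [X1 oX1 X1A] := open_normal_basis nA1.
have := open_normalI oX1 oU; set X0 := _ `&` _ => oX0.
have [_ [sX0 _ _]] := oX0.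
pose X := [set x | exists c x0, [/\ comm_sub U c, X0 x0 & x = c ** x0]].
have oX : open_normal X := open_normal_prod nC oX0.
have XU : X `<=` U.
  move=> _ [c [x [Cc [_ Ux] ->]]]; apply: (subgroupM sU) => //.
  exact: (comm_sub_sub sU Cc).
have CX : comm_sub U `<=` X.
  by move=> c Cc; exists c, one; split => //; [exact: (subgroup1 sX0)|rewrite (gmulx1 profinite_groupA)].
have [Q [pi qX]] := open_fquot oX.
have [] := fquot_gen_lift (S := R) qX _ (Hl X Q pi oX CX XU qX u Uu).
  by move=> q; rewrite finset.in_set => /mapP[x xl ->]; exists x => //; exact: RE.
move=> g Rg /(fquot_eq profinite_groupA qX) [c [x [Cc [X1x Ux] e]]].
exists (g ** c); split.
  apply: (subgroupM sG); last by apply: gen_incl; right.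
  by apply: (gen_min sG _ Rg) => y Ry; apply: gen_incl; left.
have -> : g ** c = u ** inv x by rewrite -[u](gmulVK profinite_groupA g) e !gmulA (gmulxK profinite_groupA).
by apply: X1A; case: oX1 => _ [sX1 _ _]; exact: (subgroupV sX1).
Qed.

(** * The gradient in terms of generators and index *)

Lemma dH1_ge0 U : (0 <= dH1 mul inv one U)%E.
Proof. by apply: le_ereal_inf_tmp => _ [n _ <-]; rewrite lee_fin ler0n. Qed.

(** All ratios are nonnegative, so only an upper bound is at stake, and n / m < 1 / K below every V
    provides it. The premise is purely arithmetical, ready to be negated. *)
Lemma gradient_eq0 :
    (forall V (K : nat), open_normal V -> exists U n m,
       [/\ open_normal U, U `<=` V, ab_top_gen mul inv one U n,
           index_in mul inv [set: T] U m & (K * n < m)%N]) ->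
  normal_homology_rank_gradient mul inv one = 0%E.
Proof.
move=> HK; apply/eqP; rewrite eq_le; apply/andP; split.
  apply: ge_ereal_sup => _ [V oV <-].
  apply/lee_addgt0Pr => e e0; rewrite add0e.
  pose K := (Num.truncn e^-1).+1.
  have [U [n [m [oU UV Un Um Knm]]]] := HK V K oV.
  apply: le_trans (_ : dH1_ratio mul inv one U <= _)%E.
    by apply: ereal_inf_lbound; exists U.
  apply: le_trans (_ : dH1 mul inv one U * ((m%:R)^-1)%:E <= _)%E.
    by apply: ereal_inf_lbound; exists m.
  have m0 : (0 < m)%N by exact: leq_ltn_trans Knm.
  apply: le_trans (_ : (n%:R)%:E * ((m%:R)^-1)%:E <= _)%E.
    apply: lee_wpmul2r; first by rewrite lee_fin invr_ge0 ler0n.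
    by apply: ereal_inf_lbound; exists n.
  rewrite -EFinM lee_fin ler_pdivrMr ?ltr0n //.
  have Ke : (e^-1 <= K%:R)%R by apply/ltW/truncnS_gt.
  rewrite -ler_pdivrMl // (le_trans (ler_wpM2r (ler0n _ _) Ke)) //.
  by rewrite -natrM ler_nat ltnW.
apply: le_trans (_ : ereal_inf [set dH1_ratio mul inv one U | U in [set U | open_normal U /\ U `<=` setT]] <= _)%E.
  apply: le_ereal_inf_tmp => _ [U [oU _] <-]; apply: le_ereal_inf_tmp => _ [m _ <-].
  by apply: mule_ge0; [exact: dH1_ge0|rewrite lee_fin invr_ge0 ler0n].
apply: ereal_sup_ubound; exists setT => //; split; first exact: openT.
by split.
Qed.

(** * Powers, images and orders in finite quotients *)

Definition gpow y k := iter k (mul y) one.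

Lemma fquot_pow X (Q : finGroupType) (pi : T -> Q) y k :
  fquot X pi -> pi (gpow y k) = (pi y ^+ k)%g.
Proof.
move=> qX; elim: k => [|k IHk]; first exact: (fquot1 profinite_groupA qX).
by rewrite expgS -IHk -(fquotM qX).
Qed.

Lemma gpow_in H y k : subgroup H -> H y -> H (gpow y k).
Proof.
by move=> sH Hy; elim: k => [|k IHk]; [exact: (subgroup1 sH)|exact: (subgroupM sH Hy IHk)].
Qed.

Lemma gconj_gpow x y k : gconj x y = x -> gconj x (gpow y k) = x.
Proof.
move=> xy; elim: k => [|k IHk]; first exact: (gconjx1 profinite_groupA).
by rewrite /= (gconj_mul profinite_groupA) xy.
Qed.

Lemma gconj_gpow_self y k : gconj (gpow y k) y = gpow y k.
Proof.
elim: k => [|k IHk]; first exact: (gconj1x profinite_groupA).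
by rewrite /= (gconjM profinite_groupA) IHk /gconj (gmulVx profinite_groupA) (gmul1x profinite_groupA).
Qed.

Lemma fquot_sub X Y (Q Q' : finGroupType) (pi : T -> Q) (pi' : T -> Q') x y :
  fquot X pi -> fquot Y pi' -> X `<=` Y -> pi x = pi y -> pi' x = pi' y.
Proof. by move=> qX qY XY /(fquot_eq profinite_groupA qX)/XY/(fquot_eq profinite_groupA qY). Qed.

Lemma gpowM x a b : gpow (gpow x a) b = gpow x (a * b).
Proof.
suff e : gpow (gpow x a) b ** inv (gpow x (a * b)) = one.
  by rewrite -[LHS](gmulxVK profinite_groupA (gpow x (a * b))) e (gmul1x profinite_groupA).
apply: contrapT => /(open_normal_sep)[X oX]; apply.
have [Q [pi qX]] := open_fquot oX; apply/(fquotP qX).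
by rewrite (fquotM qX) (fquotV profinite_groupA qX) !(fquot_pow _ _ qX) expgM mulgV.
Qed.

Lemma fquot_comm X (Q : finGroupType) (pi : T -> Q) U a b :
  fquot X pi -> comm_sub U `<=` X -> U a -> U b -> commute (pi a) (pi b).
Proof.
move=> qX CX Ua Ub; apply/commgP.
have /CX/(fquotP qX) : comm_sub U (inv a ** inv b ** (a ** b)).
  by apply: gen_incl; exists a => //; exists b.
rewrite !(fquotM qX) !(fquotV profinite_groupA qX) => e.
by apply/eqP; rewrite commgEl conjgE -e !mulgA.
Qed.

Lemma fquot_image X U (Q : finGroupType) (pi : T -> Q) :
    fquot X pi -> subgroup U -> X `<=` U ->
  exists E : {group Q}, forall x, pi x \in E <-> U x.
Proof.
move=> qX sU XU.
pose P : {set Q} := finset (fun q => `[< exists2 g, U g & pi g = q >]).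
have PE x : pi x \in P <-> U x.
  rewrite finset.in_set; split=> [/asboolP[g Ug /(fquot_eq profinite_groupA qX)/XU h]|Ux].
    by rewrite -(gmulVK profinite_groupA g x); exact: (subgroupM sU).
  by apply/asboolP; exists x.
have gP : group_set P.
  apply/group_setP; split.
    by rewrite -(fquot1 profinite_groupA qX); apply/PE/(subgroup1 sU).
  move=> a b; have [g <-] := fquot_surj qX a; have [h <-] := fquot_surj qX b.
  by rewrite -(fquotM qX) => /PE Ug /PE Uh; apply/PE/(subgroupM sU).
by exists (Group gP).
Qed.

Lemma fquot_image_normal X U (Q : finGroupType) (pi : T -> Q) (E : {group Q}) :
    fquot X pi -> normal_in mul inv one [set: T] U ->
    (forall x, pi x \in E <-> U x) -> normal E [set: Q]%SET.
Proof.
move=> qX [_ _ nU] EU; rewrite /normal finset.subsetT /=.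
apply/fintype.subsetP=> q _; have [g <-] := fquot_surj qX q.
rewrite inE; apply/fintype.subsetP=> e; rewrite mem_conjg; have [x <-] := fquot_surj qX e.
rewrite -(fquotV profinite_groupA qX) -(fquotJ profinite_groupA qX) => /EU h; apply/EU.
by rewrite -(gconjK profinite_groupA x (inv g)) (ginvK profinite_groupA); exact: nU.
Qed.

(** The induced map from Q onto Q0 has kernel E. *)
Lemma card_fquot X U (Q Q0 : finGroupType) (pi : T -> Q) (pi0 : T -> Q0) (E : {group Q}) :
    fquot X pi -> fquot U pi0 -> X `<=` U -> (forall x, pi x \in E <-> U x) ->
  #|Q| = (#|E| * #|Q0|)%N.
Proof.
move=> qX q0 XU EU.
pose lift q := projT1 (cid (fquot_surj qX q)).
have liftE q : pi (lift q) = q by rewrite /lift; case: cid.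
pose f q := pi0 (lift q).
have fE x : f (pi x) = pi0 x by apply: (fquot_sub qX q0 XU).
have fM : {in [set: Q]%SET &, {morph f : a b / (a * b)%g}}.
  move=> a b _ _; have [g <-] := fquot_surj qX a; have [h <-] := fquot_surj qX b.
  by rewrite -(fquotM qX) !fE (fquotM q0).
pose F := Morphism fM.
have kerF : ('ker F)%g = E.
  apply/setP=> q; rewrite !inE /=; have [g <-] := fquot_surj qX q.
  by rewrite fE; apply/eqP/idP => [/(fquotP q0)/EU|/EU/(fquotP q0)].
have imF : (F @* [set: Q]%SET)%g = [set: Q0]%SET.
  apply/setP=> q; rewrite !inE; have [g <-] := fquot_surj q0 q.
  by rewrite -fE; apply/morphimP; exists (pi g); rewrite ?inE.
have := card_morphim F [set: Q]%SET; rewrite imF kerF finset.setIid finset.cardsT => ->.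
by rewrite Lagrange ?finset.subsetT // finset.cardsT.
Qed.

(* U1 is the closure of [U, U]; this form avoids proving that the closure is
   open. *)
Lemma smallest_open_normal U b : open_normal U ->
    (forall X (Q : finGroupType) (pi : T -> Q), open_normal X -> comm_sub U `<=` X ->
       X `<=` U -> fquot X pi -> (#|Q| <= b)%N) ->
  exists U1, [/\ open_normal U1, comm_sub U `<=` U1, U1 `<=` U &
    forall X, open_normal X -> comm_sub U `<=` X -> X `<=` U -> U1 `<=` X].
Proof.
(* An admissible X of maximal index lies in every admissible Y, since its intersection with Y is
   admissible and cannot have larger index. *)
move=> oU bd; pose P n := exists (X : set T) (Q : finGroupType) (pi : T -> Q),
  [/\ open_normal X, comm_sub U `<=` X, X `<=` U, fquot X pi & #|Q| = n].
have exP : exists n, `[< P n >].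
  have [Q [pi qU]] := open_fquot oU; exists #|Q|; apply/asboolP.
  exists U, Q, pi; split => //.
  by have [_ [sU _ _]] := oU; exact: comm_sub_sub.
have ubP n : `[< P n >] -> (n <= b)%N.
  by move=> /asboolP[X [Q [pi [oX CX XU qX <-]]]]; exact: bd qX.
case: (ex_maxnP exP ubP) => n /asboolP[X [Q [pi [oX CX XU qX eQ]]]] maxn.
exists X; split => // Y oY CY YU.
have oXY := open_normalI oX oY.
have [Q' [pi' qXY]] := open_fquot oXY.
have le : (#|Q'| <= #|Q|)%N.
  rewrite eQ; apply/maxn/asboolP; exists (X `&` Y), Q', pi'; split => //.
    by move=> c Cc; split; [exact: CX|exact: CY].
  by move=> z [/XU].
have subX : X `&` Y `<=` X by move=> z [].
pose h q := pi' (projT1 (cid (fquot_surj qX q))).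
have hE q : exists2 x, pi x = q & h q = pi' x.
  by rewrite /h; case: cid => x ex /=; exists x.
have injh : injective h.
  move=> q q'; have [x <- ->] := hE q; have [x' <- ->] := hE q'.
  exact: (fquot_sub qXY qX subX).
have [k hk kh] := inj_card_bij injh le.
have h1 z : X z -> pi' z = h 1%g.
  move=> Xz; rewrite -[pi' z]kh; congr h; have [x ex] := hE (k (pi' z)).
  rewrite kh => e; rewrite -ex -(fquot_sub qXY qX subX e).
  exact/(fquotP qX).
move=> z Xz; suff [] : (X `&` Y) z by [].
apply/(fquotP qXY); rewrite h1 // -(h1 one) ?(fquot1 profinite_groupA qXY) //.
by have [_ [sX _ _]] := oX; exact: (subgroup1 sX).
Qed.

(** * Generators of H_1(U1) *)

Section Generators.
Variables (U U1 : set T) (Q1 : finGroupType) (pi1 : T -> Q1) (E : {group Q1}).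
Variables (y : T) (o : nat) (lU : seq T) (S : {set Q1}) (sigma : Q1 -> T).
Hypotheses (oU : open_normal U) (oU1 : open_normal U1).
Hypotheses (CU1 : comm_sub U `<=` U1) (U1U : U1 `<=` U) (q1 : fquot U1 pi1).
Hypothesis minU1 : forall X, open_normal X -> comm_sub U `<=` X -> X `<=` U -> U1 `<=` X.
Hypothesis EU : forall x, pi1 x \in E <-> U x.
Hypothesis exp_y : forall v, U v -> gpow (y ** v) o = one.
Hypothesis lUU : forall u, u \in lU -> U u.
Hypothesis genU : forall X (Q : finGroupType) (pi : T -> Q) u, open_normal X ->
  X `<=` U -> fquot X pi -> U u -> exists2 g, gen [set` lU] g & pi g = pi u.
Hypothesis sigmaE : forall q, pi1 (sigma q) = q.
Hypothesis spanS : forall (V : zmodType) (act : V -> Q1 -> V) (P : V -> Prop) (v : V),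
  (forall u v g, act (u - v)%R g = (act u g - act v g)%R) ->
  (forall v g h, act v (g * h)%g = act (act v g) h) ->
  (forall v, act v 1%g = v) ->
  (forall v, (\sum_(i < o) act v (pi1 y ^+ i)%g = 0)%R) ->
  P 0%R -> (forall u v, P u -> P v -> P (u - v)%R) ->
  {in S, forall s, P (act v s)} -> {in E, forall e, P (act v e)}.

Let comm a b := inv a ** inv b ** (a ** b).
(** [U,U] is generated by the U-conjugates of commutators of generators. Modulo [U1,U1] a conjugator
    counts only through its class in E, and [spanS] cuts these classes down to S. *)
Let gens := [seq gconj (comm ab.1 ab.2) (sigma s) | ab <- [seq (a, b) | a <- lU, b <- lU],
                                              s <- enum S].

Lemma gens_in_U1 x : x \in gens -> U1 x.
Proof.
move=> /allpairsP[[[a b] s] /= [/allpairsP[[a' b'] /= [al bl [-> ->]]] sS ->]].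
have [_ [_ _ nU1]] := oU1; apply: nU1 => //; apply: CU1; apply: gen_incl.
by exists a'; [exact: lUU|exists b' => //; exact: lUU].
Qed.

Lemma conj_comm_in X (Q : finGroupType) (pi : T -> Q) (H : {group Q}) a b u :
    open_normal X -> comm_sub U1 `<=` X -> X `<=` U1 -> fquot X pi ->
    (forall x, x \in gens -> pi x \in H) -> a \in lU -> b \in lU -> U u ->
  pi (gconj (comm a b) u) \in H.
Proof.
move=> oX CX XU1 qX gensH al bl Uu.
have [_ [sU1 _ _]] := oU1.
have [A AU1] := fquot_image qX sU1 XU1.
have nA : normal A [set: Q]%SET by apply: (fquot_image_normal qX oU1.2 AU1).
have NA q : q \in 'N(A)%g by apply: (fintype.subsetP (normal_norm nA)); rewrite inE.
have abA : abelian A.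
  apply/centsP=> c cA d dA; move: cA dA.
  have [x <-] := fquot_surj qX c; have [z <-] := fquot_surj qX d.
  by move=> /AU1 U1x /AU1 U1z; exact: (fquot_comm qX CX).
(* As A is abelian, conjugation by a lift does not depend on the lift, which makes this an action of
   Q1. *)
pose act (v : FiniteModule.fmod_of abA) (q : Q1) := FiniteModule.actr v (pi (sigma q)).
have actE v t : act v (pi1 t) = FiniteModule.actr v (pi t).
  have /(fquot_eq profinite_groupA q1) : pi1 t = pi1 (sigma (pi1 t)) by rewrite sigmaE.
  move=> h; rewrite /act; have -> : sigma (pi1 t) = t ** (inv t ** sigma (pi1 t)).
    by rewrite (gmulVK profinite_groupA).
  rewrite (fquotM qX) FiniteModule.actrM //.
  apply: val_inj; rewrite FiniteModule.fmvalJ // conjgE.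
  rewrite (centsP abA _ (FiniteModule.fmodP _) (pi _)) ?mulKg //.
  exact/AU1.
have actB u' v g : act (u' - v)%R g = (act u' g - act v g)%R.
  by rewrite /act FiniteModule.actAr FiniteModule.actNr.
have actM v g h : act v (g * h)%g = act (act v g) h.
  by rewrite -(sigmaE g) -(sigmaE h) -(fquotM q1) !actE (fquotM qX) FiniteModule.actrM.
have act1 v : act v 1%g = v.
  by rewrite -(fquot1 profinite_groupA q1) actE (fquot1 profinite_groupA qX) FiniteModule.actr1.
have pow_y v : U v -> ((pi y * pi v) ^+ o = 1)%g.
  by move=> Uv; rewrite -(fquotM qX) -(fquot_pow _ _ qX) exp_y // (fquot1 profinite_groupA qX).
have norm0 v : (\sum_(i < o) act v (pi1 y ^+ i)%g = 0)%R.
  have [x ex] := fquot_surj qX (val v).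
  have U1x : U1 x by apply/AU1; rewrite ex; exact: FiniteModule.fmodP.
  apply: val_inj; rewrite FiniteModule.fmval0.
  have := expgM_fmod abA o (NA (pi y)) (FiniteModule.fmodP v).
  have y1 : (pi y ^+ o = 1)%g.
    have [_ [sU _ _]] := oU; have := pow_y one (subgroup1 sU).
    by rewrite (fquot1 profinite_groupA qX) mulg1.
  rewrite -[val v]ex pow_y ?y1 ?mul1g; last exact: U1U.
  move=> ->; rewrite ex; congr val; apply: eq_bigr => i _.
  by rewrite -(fquot_pow _ _ q1) actE (fquot_pow _ _ qX) FiniteModule.fmvalK.
have Hv (v : FiniteModule.fmod_of abA) q : val (act v q) = (val v ^ pi (sigma q))%g.
  by rewrite /act FiniteModule.fmvalJ.
have U1r : U1 (comm a b).
  by apply: CU1; apply: gen_incl; exists a; [exact: lUU|exists b => //; exact: lUU].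
pose v := FiniteModule.fmod abA (pi (comm a b)).
have vE : val v = pi (comm a b) by rewrite FiniteModule.fmodK //; exact/AU1.
have := @spanS _ act (fun v => val v \in H) v actB actM act1 norm0 (group1 H).
have PB (u' v' : FiniteModule.fmod_of abA) : val u' \in H -> val v' \in H -> val (u' - v')%R \in H.
  by move=> uH vH; rewrite FiniteModule.fmvalA FiniteModule.fmvalN groupM ?groupV.
move=> /(_ PB) span.
have {}span := span _ _ (proj2 (EU u) Uu).
rewrite (fquotJ profinite_groupA qX) -vE -FiniteModule.fmvalJ // -actE; apply: span.
move=> s sS; rewrite Hv vE -(fquotJ profinite_groupA qX); apply: gensH.
by apply/allpairsP; exists ((a, b), s); rewrite mem_enum; split => //; exact: allpairs_f.
Qed.

Lemma ab_top_gen_commutators : ab_top_gen mul inv one U1 (size lU * size lU * #|S|)%N.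
Proof.
have -> : (size lU * size lU * #|S|)%N = size gens.
  by rewrite !size_allpairs -cardE.
apply: (ab_top_gen_finite_quotients oU1) => [x|X Q pi oX CX XU1 qX u U1u]; first exact: gens_in_U1.
set H := <<_>>%g.
have gensH x : x \in gens -> pi x \in H.
  by move=> xg; rewrite mem_gen // finset.in_set; exact: map_f.
have [_ [sU _ nU]] := oU; have [_ [sX _ nX]] := oX.
have XU : X `<=` U by exact: subset_trans XU1 U1U.
have [EX EXU] := fquot_image qX sU XU.
have commH : {in EX &, forall a b, [~ a, b]%g \in H}.
  apply: (commg_gen_in (U := EX) (H := <<_>>%G) (D := finset (mem [seq pi x | x <- lU]))).
    apply/eqP; rewrite finset.eqEsubset; apply/andP; split.
      apply/fintype.subsetP=> q; have [x <-] := fquot_surj qX q => /EXU Ux.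
      have [g gg <-] := genU oX XU qX Ux.
      apply: (fquot_gen_sub (D := <<_>>%G) qX _ gg) => z zl.
      by rewrite mem_gen // finset.in_set; exact: map_f.
    rewrite gen_subG; apply/fintype.subsetP=> q; rewrite finset.in_set => /mapP[x xl ->].
    exact/EXU/lUU.
  move=> q r c; rewrite !finset.in_set => /mapP[a al ->] /mapP[b bl ->].
  have [x <-] := fquot_surj qX c => /EXU Ux.
  have := @conj_comm_in _ _ _ <<_>>%G a b x oX CX XU1 qX gensH al bl Ux.
  by rewrite (fquotJ profinite_groupA qX) !(fquotM qX) !(fquotV profinite_groupA qX) commgEl conjgE !mulgA.
have nC := comm_sub_normal profinite_groupA oU.2; have [sC _ _] := nC.
(* Minimality of U1 against [U,U] X: modulo X every element of U1 comes from [U,U]. *)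
have [||c [x0 [Cc Xx0 ->]]] := @minU1 _ (open_normal_prod nC oX) _ _ u U1u.
- by move=> c Cc; exists c, one; split => //; [exact: (subgroup1 sX)|rewrite (gmulx1 profinite_groupA)].
- move=> _ [c [x0 [Cc /XU Ux0 ->]]]; apply: (subgroupM sU) => //; exact/U1U/CU1.
rewrite (fquotM qX) ((fquotP qX x0).1 Xx0) mulg1.
apply: (fquot_gen_sub (D := <<_>>%G) qX _ Cc) => _ [a Ua [b Ub <-]].
have := commH _ _ ((EXU a).2 Ua) ((EXU b).2 Ub).
by rewrite !(fquotM qX) !(fquotV profinite_groupA qX) commgEl conjgE !mulgA.
Qed.

End Generators.

(** By minimality of U1 every finite quotient of U to be tested factors through E, so lifts of a
    basis of E generate. *)
Lemma ab_top_gen_abelem U U1 (Q1 : finGroupType) (pi1 : T -> Q1) (E : {group Q1}) p :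
    open_normal U -> fquot U1 pi1 -> U1 `<=` U ->
    (forall X, open_normal X -> comm_sub U `<=` X -> X `<=` U -> U1 `<=` X) ->
    (forall x, pi1 x \in E <-> U x) -> (p.-abelem E)%g ->
  ab_top_gen mul inv one U (logn p #|E|).
Proof.
move=> oU q1 U1U minU1 EU pE.
have [B defE cardB] := grank_witness E.
rewrite -(rank_abelem pE) -(grank_abelian (abelem_abelian pE)) -cardB.
pose lift q := projT1 (cid (fquot_surj q1 q)).
have liftE q : pi1 (lift q) = q by rewrite /lift; case: cid.
have -> : #|B| = size [seq lift b | b <- enum B] by rewrite size_map -cardE.
apply: (ab_top_gen_finite_quotients oU) => [_ /mapP[b bB ->]|X Q pi oX CX XU qX u Uu].
  by apply/EU; rewrite liftE -defE mem_gen // -mem_enum.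
have uB : pi1 u \in <<B>>%g by rewrite defE; apply/EU.
have [|g gg eg] := fquot_gen_lift (S := [set` [seq lift b | b <- enum B]]) q1 _ uB.
  by move=> b bB; exists (lift b) => //; apply: map_f; rewrite mem_enum.
rewrite -(fquot_sub q1 qX (minU1 X oX CX XU) eg).
apply: (fquot_gen_sub (D := <<_>>%G) qX _ gg) => z zl.
by rewrite mem_gen // finset.in_set; exact: map_f.
Qed.

(** * Normal closures in a dense just infinite subgroup *)

Variables (G : set T) (lG : seq T).
Hypothesis defG : G = gen [set` lG].
Hypothesis dG : closure G = [set: T].
Hypothesis jiG : forall N, normal_in mul inv one G N -> N <> [set one] ->
  finite_index mul inv G N.
Hypothesis infG : infinite_set G.

Lemma dense_subgroup : subgroup G. Proof. by rewrite defG; exact: gen_subgroup. Qed.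

Lemma fquot_dense X (Q : finGroupType) (pi : T -> Q) x :
  open X -> fquot X pi -> exists2 g, G g & pi g = pi x.
Proof. by move=> oX qX; apply: (closure_fquot oX qX); rewrite dG. Qed.

Local Notation normal_gen := (normal_gen mul inv one G).
Definition closed_normal_gen x := closure (normal_gen x).

Lemma normal_gen_finite_index x : G x -> x <> one -> finite_index mul inv G (normal_gen x).
Proof.
move=> Gx x1; apply: jiG; first exact: (normal_gen_normal profinite_groupA dense_subgroup Gx).
by move=> e; apply: x1; have := mem_normal_gen profinite_groupA (x := x) dense_subgroup; rewrite e.
Qed.

Lemma mem_closed_normal_gen x : closed_normal_gen x x.
Proof. by apply: subset_closure; exact: (mem_normal_gen profinite_groupA (x := x) dense_subgroup). Qed.

(** Finitely many translates of the closure cover G, hence everything by density, and a closed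
    subgroup of finite index is open. Normality extends from G by continuity of conjugation. *)
Lemma closed_normal_gen_open_normal x : G x -> x <> one -> open_normal (closed_normal_gen x).
Proof.
move=> Gx x1; have [sN _ nN] := normal_gen_normal profinite_groupA dense_subgroup Gx.
have sM : subgroup (closed_normal_gen x) := closure_subgroup sN.
have cM : closed (closed_normal_gen x) by exact: closed_closure.
split; last first.
  split=> // k h _ Mh.
  have cA : closed [set g | closed_normal_gen x (gconj h g)].
    apply: (@preimage_closed _ _ (fun g => gconj h g)) => // g _.
    exact: (continuous_gconjr).
  have : closure G `<=` [set g | closed_normal_gen x (gconj h g)].
    move/closure_id: cA => ->; apply: closureS => g Gg A.
    move=> /(continuous_gconj (g := g)) nA; have [a [Na Aa]] := Mh _ nA.
    by exists (gconj a g); split => //; exact: nN.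
  by rewrite dG; exact.
have [n [f [fG fP]]] := normal_gen_finite_index Gx x1.
pose l := [seq f i | i <- enum 'I_n].
apply: (@closed_cover_open _ l) => // y.
have cA : closed (\bigcup_(d in [set` l]) [set y | closed_normal_gen x (inv d ** y)]).
  by apply: closed_bigcup => [|d _]; [exact: finite_seq|exact: (closed_translate)].
have : closure G `<=` \bigcup_(d in [set` l]) [set y | closed_normal_gen x (inv d ** y)].
  move/closure_id: cA => ->; apply: closureS => g Gg.
  have [i [Ni _]] := fP g Gg; exists (f i); first by apply: map_f; rewrite mem_enum.
  exact: subset_closure.
by rewrite dG => /(_ y I) [d dl Md]; exists d.
Qed.

Lemma closed_normal_gen_sub x V : open_normal V -> V x -> closed_normal_gen x `<=` V.
Proof.
move=> [oV [sV _ nV]] Vx; have cV := open_subgroup_closed oV sV.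
move/closure_id: cV => ->; apply: closureS; apply: gen_min => // _ [g _ <-].
exact: nV.
Qed.

Lemma fquot_closed_normal_gen X (Q : finGroupType) (pi : T -> Q) x z :
  open X -> fquot X pi -> closed_normal_gen x z -> pi z \in <<class (pi x) [set: Q]%SET>>%g.
Proof.
move=> oX qX Mz; have [n Nn <-] := closure_fquot oX qX Mz.
apply: (fquot_gen_sub (D := <<class (pi x) [set: Q]%SET>>%G) qX _ Nn) => _ [g _ <-].
by rewrite (fquotJ profinite_groupA qX) mem_gen // memJ_class ?finset.in_setT.
Qed.

(** Modulo [M,M], with M the closure, the conjugate of x by c t u depends on t alone: c centralises
    x, and u lies in M. *)
Lemma ab_top_gen_closed_normal_gen x l : G x -> x <> one ->
    (forall g, exists c t u, [/\ t \in l, closed_normal_gen x u, gconj x c = x & g = c ** t ** u]) ->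
  ab_top_gen mul inv one (closed_normal_gen x) (size l).
Proof.
move=> Gx x1 cov; have oM := closed_normal_gen_open_normal Gx x1; have [_ [_ _ nM]] := oM.
rewrite -(size_map (gconj x)); apply: (ab_top_gen_finite_quotients oM).
  by move=> _ /mapP[t _ ->]; apply: nM => //; exact: mem_closed_normal_gen.
move=> X Q pi [oX _] CX XM qX u Mu.
have := fquot_closed_normal_gen oX qX Mu; apply/fintype.subsetP.
rewrite gen_subG; apply/fintype.subsetP=> _ /imsetP[q _ ->].
have [g <-] := fquot_surj qX q; have [c [t [v [tl Mv cx ->]]]] := cov g.
rewrite -(fquotJ profinite_groupA qX) (gconj_mul profinite_groupA) (gconj_mul profinite_groupA) cx (fquotJ profinite_groupA qX).
have Mc : closed_normal_gen x (gconj x t) by apply: nM => //; exact: mem_closed_normal_gen.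
rewrite conjgE (fquot_comm qX CX Mc Mv) mulKg mem_gen //.
by rewrite finset.in_set; apply: map_f; exact: map_f.
Qed.

(** For z = y^k both lists are fixed before w is chosen. They form one pair so that a single
    [choice] yields them for all k. *)
Lemma normal_gen_generators_reps z : G z -> z <> one -> exists FR : seq T * seq T,
  normal_gen z = gen [set` [seq gconj z g | g <- FR.1]] /\
  forall x, G x -> exists2 r, r \in FR.2 & normal_gen z (inv r ** x).
Proof.
move=> Gz z1; have [m iN] := normal_gen_finite_index Gz z1.
have [sN NG _] := normal_gen_normal profinite_groupA dense_subgroup Gz.
have [l _ Nl] := schreier profinite_groupA defG sN NG iN.
have [l' l'N Nl'] := gen_finite_list Nl.
have [F defF] : exists F : seq T, l' = [seq gconj z g | g <- F].
  elim: l' l'N {Nl'} => [_|s l' IHl l'N]; first by exists [::].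
  have [|F ->] := IHl; first by move=> t tl; apply: l'N; rewrite inE tl orbT.
  by have [g _ <-] := l'N s (mem_head _ _); exists (g :: F).
have [f [_ fP]] := iN.
exists (F, [seq f i | i <- enum 'I_m]) => /=; split; first by rewrite -defF.
move=> x /fP[i [Ni _]]; exists (f i) => //.
by apply: map_f; rewrite mem_enum.
Qed.

(** Since U acts trivially on E, w has at most #|Q0| conjugates in E, each of order dividing p. The
    resulting bound on #|E| feeds [smallest_open_normal]. *)
Lemma abelianization_closed_normal_gen w p U X (Q Q0 : finGroupType) (pi : T -> Q)
    (pi0 : T -> Q0) (E : {group Q}) :
    G w -> w <> one -> gpow w p = one -> prime p -> U = closed_normal_gen w -> fquot U pi0 ->
    open_normal X -> comm_sub U `<=` X -> X `<=` U -> fquot X pi ->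
    (forall x, pi x \in E <-> U x) ->
  [/\ (p.-abelem E)%g, E :=: <<class (pi w) [set: Q]%SET>>%g & (#|E| <= p ^ #|Q0|)%N].
Proof.
move=> Gw w1 wp p_pr defU q0 oX CX XU qX EU.
have oU : open_normal U by rewrite defU; exact: (closed_normal_gen_open_normal Gw w1).
have [_ [sU _ nU]] := oU.
have Uw : U w by rewrite defU; exact: (mem_closed_normal_gen).
have abE : abelian E.
  apply/centsP=> a aE b bE; move: aE bE.
  have [x <-] := fquot_surj qX a; have [z <-] := fquot_surj qX b.
  by move=> /EU Ux /EU Uz; exact: (fquot_comm qX CX).
have defE : E :=: <<class (pi w) [set: Q]%SET>>%g.
  apply/eqP; rewrite finset.eqEsubset; apply/andP; split.
    apply/fintype.subsetP=> q; have [x <-] := fquot_surj qX q => /EU.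
    by rewrite defU => Ux; exact: (fquot_closed_normal_gen oX.1 qX Ux).
  rewrite gen_subG; apply/fintype.subsetP=> _ /imsetP[q _ ->].
  by have [g <-] := fquot_surj qX q; rewrite -(fquotJ profinite_groupA qX); apply/EU/nU.
have wp' : (pi w ^+ p = 1)%g by rewrite -(fquot_pow _ _ qX) wp (fquot1 profinite_groupA qX).
split=> //.
  apply: (abelem_gen_class p_pr abE defE) => _ /imsetP[q _ ->].
  by rewrite -conjXg wp' conj1g.
pose lift q := projT1 (cid (fquot_surj q0 q)).
have liftE q : pi0 (lift q) = q by rewrite /lift; case: cid.
have [|P [_ leP /allP inP]] :=
  @abelian_join_bound _ E p [seq <[pi (gconj w (lift q))]>%G | q <- enum Q0] abE.
  apply/allP=> _ /mapP[q _ ->]; rewrite /= cycle_subG; apply/andP; split.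
    by apply/EU/nU.
  rewrite -orderE (fquotJ profinite_groupA qX) orderJ; apply: dvdn_leq (prime_gt0 p_pr) _.
  by rewrite order_dvdn wp'.
rewrite size_map -cardT in leP; apply: leq_trans leP; apply: subset_leq_card.
rewrite defE gen_subG; apply/fintype.subsetP=> _ /imsetP[q _ ->].
have [g <-] := fquot_surj qX q.
have [u Uu ->] : exists2 u, U u & g = lift (pi0 g) ** u.
  exists (inv (lift (pi0 g)) ** g); last by rewrite (gmulVK profinite_groupA).
  by apply/(fquot_eq profinite_groupA q0).
rewrite -(fquotJ profinite_groupA qX) (gconj_mul profinite_groupA) (fquotJ profinite_groupA qX).
have Uc : U (gconj w (lift (pi0 g))) by apply: nU.
rewrite conjgE (fquot_comm qX CX Uc Uu) mulKg.
have := inP _ (map_f _ (mem_enum Q0 (pi0 g))); rewrite /= cycle_subG; exact.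
Qed.

Lemma index_dense U (Q0 : finGroupType) (pi0 : T -> Q0) : open U -> fquot U pi0 ->
  subgroup U -> index_in mul inv G (G `&` U) #|Q0|.
Proof.
move=> oU q0 sU.
have rep q : exists2 g, G g & pi0 g = q.
  by have [x <-] := fquot_surj q0 q; exact: (fquot_dense x oU q0).
pose f (i : 'I_#|Q0|) : T := projT1 (cid2 (rep (enum_val i))).
have fG i : G (f i) by rewrite /f; case: cid2.
have fE i : pi0 (f i) = enum_val i by rewrite /f; case: cid2.
exists f; split=> // x Gx; exists (enum_rank (pi0 x)); split.
  split; first by apply: (subgroupM dense_subgroup) => //; exact: (subgroupV dense_subgroup).
  by apply/(fquot_eq profinite_groupA q0); rewrite fE enum_rankK.
by move=> i [_ /(fquot_eq profinite_groupA q0) <-]; rewrite fE enum_valK.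
Qed.

(** * Consequences of a linear lower bound on d(H_1) *)

Variables (V : set T) (K : nat).
Hypothesis K_gt0 : (0 < K)%N.
Hypothesis oV : open_normal V.
Hypothesis HK : forall U n m, open_normal U -> U `<=` V ->
  ab_top_gen mul inv one U n -> index_in mul inv [set: T] U m -> (m <= K * n)%N.

(** As y centralises its power x, the cosets of <y> modulo M, of which there are m divided by the
    order of y modulo M, give enough generators of H_1(M). Passing from X to the smaller M cannot
    decrease this order. *)
Lemma order_le_K y k X (Q : finGroupType) (pi : T -> Q) : G y -> gpow y k <> one ->
  open_normal X -> X `<=` V -> X (gpow y k) -> fquot X pi -> (#[pi y]%g <= K)%N.
Proof.
move=> Gy x1 oX XV Xx qX; set x := gpow y k in x1 Xx.
have Gx : G x by exact: (gpow_in _ dense_subgroup).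
have oM := closed_normal_gen_open_normal Gx x1; have MX := closed_normal_gen_sub oX Xx.
have [Q0 [pi0 q0]] := open_fquot oM.
have le1 : (#[pi y]%g <= #[pi0 y]%g)%N.
  apply: dvdn_leq => //; rewrite order_dvdn -(fquot_pow _ _ qX).
  apply/eqP/(fquotP qX)/MX/(fquotP q0).
  by rewrite (fquot_pow _ _ q0) expg_order.
apply: leq_trans le1 _.
pose lift q := projT1 (cid (fquot_surj q0 q)).
have liftE q : pi0 (lift q) = q by rewrite /lift; case: cid.
pose C := <[pi0 y]>%g.
pose l := [seq lift (repr D) | D <- enum (rcosets C [set: Q0]%SET)].
have genl : ab_top_gen mul inv one (closed_normal_gen x) (size l).
  apply: ab_top_gen_closed_normal_gen => // g.
  have [c /cycleP[i ->] e] := rcosetP (mem_repr_rcoset <[pi0 y]>%G (pi0 g)).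
  pose t := lift (repr (C :* pi0 g)%g).
  have [j ej] : exists j, ((pi0 y ^+ i)^-1 = pi0 y ^+ j)%g.
    by apply/cycleP; rewrite groupV mem_cycle.
  exists (gpow y j), t, (inv (gpow y j ** t) ** g); split.
  - by apply: map_f; rewrite mem_enum; apply/rcosetsP; exists (pi0 g); rewrite ?finset.in_setT.
  - apply/(fquot_eq profinite_groupA q0); rewrite (fquotM q0) (fquot_pow _ _ q0) -ej liftE.
    by rewrite e mulKg.
  - by apply: gconj_gpow; exact: gconj_gpow_self.
  - by rewrite (gmulVK profinite_groupA).
have := HK oM (subset_trans MX XV) genl (index_in_fquot profinite_groupA q0).
rewrite size_map -cardE -(finset.cardsT Q0) -(Lagrange (finset.subsetT <[pi0 y]>%G)).
by rewrite leq_pmul2r // indexg_gt0.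
Qed.

Lemma open_normal_sep_in x Y : x <> one -> open_normal Y ->
  exists X, [/\ open_normal X, X `<=` Y & ~ X x].
Proof.
move=> x1 oY; have [X oX nXx] := open_normal_sep x1.
exists (X `&` Y); split; first exact: (open_normalI oX oY).
  by move=> z [].
by case.
Qed.

(** If no power of w were trivial, the order of w modulo every small X would be at most K, so w^(K!)
    would lie in every such X, against separation of points. *)
Lemma torsion_dense w : G w -> exists2 n, (0 < n)%N & gpow w n = one.
Proof.
move=> Gw; apply: contrapT => ntors.
have nt n : (0 < n)%N -> gpow w n <> one by move=> n0 e; apply: ntors; exists n.
have [X [oX XV nXw]] := open_normal_sep_in (nt _ (fact_gt0 K)) oV.
have [Q [pi qX]] := open_fquot oX; apply: nXw.
apply/(fquotP qX); rewrite (fquot_pow _ _ qX).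
have Xk : X (gpow w #[pi w]%g).
  by apply/(fquotP qX); rewrite (fquot_pow _ _ qX) expg_order.
have le := order_le_K Gw (nt _ (order_gt0 (pi w))) oX XV Xk qX.
by apply/eqP; rewrite -order_dvdn dvdn_fact // order_gt0.
Qed.

Lemma infinite_neq1 : exists2 y, G y & y <> one.
Proof.
apply: contrapT => nG; apply: infG; apply: (sub_finite_set _ (finite_set1 one)) => y Gy.
by apply: contrapT => y1; apply: nG; exists y.
Qed.

Lemma fquot_pow_sub X Y (Q Q' : finGroupType) (pi : T -> Q) (pi' : T -> Q') y :
  fquot X pi -> fquot Y pi' -> X `<=` Y -> (#[pi' y]%g %| #[pi y]%g)%N.
Proof.
move=> qX qY XY; rewrite order_dvdn -(fquot_pow _ _ qY); apply/eqP/(fquotP qY)/XY.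
by apply/(fquotP qX); rewrite (fquot_pow _ _ qX) expg_order.
Qed.

(* Elements of order larger than K modulo X have exactly this order by
   order_le_K; if there are none, elements of maximal order work. *)
Lemma coset_exponent : exists (y : T) (X : set T) (Q : finGroupType) (pi : T -> Q),
  [/\ G y, open_normal X, X `<=` V, fquot X pi &
      (1 < #[pi y]%g)%N /\ forall v, X v -> gpow (y ** v) #[pi y]%g = one].
Proof.
pose P o := exists (y : T) (X : set T) (Q : finGroupType) (pi : T -> Q),
  [/\ G y, open_normal X, X `<=` V, fquot X pi & #[pi y]%g = o].
(* A nontrivial value is visible modulo some Y inside X, where v may be replaced by an element of
   G. *)
have dense y X (Q : finGroupType) (pi : T -> Q) : open_normal X -> fquot X pi ->
    (forall v, G v -> X v -> gpow (y ** v) #[pi y]%g = one) ->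
    forall v, X v -> gpow (y ** v) #[pi y]%g = one.
  move=> oX qX Hv v Xv; apply: contrapT => x1.
  have [Y [oY YX nY]] := open_normal_sep_in x1 oX.
  have [Q' [pi' qY]] := open_fquot oY; apply: nY; apply/(fquotP qY).
  have [g Gg eg] := fquot_dense v oY.1 qY.
  have Xg : X g.
    apply/(fquotP qX); have [_ [sX _ _]] := oX.
    by rewrite (fquot_sub qY qX YX eg); apply/(fquotP qX).
  rewrite (fquot_pow _ _ qY) (fquotM qY) -eg -(fquotM qY) -(fquot_pow _ _ qY).
  by rewrite Hv // (fquot1 profinite_groupA qY).
have P2 : exists2 o, (1 < o)%N & P o.
  have [y Gy y1] := infinite_neq1.
  have [X [oX XV nXy]] := open_normal_sep_in y1 oV.
  have [Q [pi qX]] := open_fquot oX.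
  exists #[pi y]%g; last by exists y, X, Q, pi.
  by rewrite order_gt1; apply/eqP => e; apply/nXy/(fquotP qX).
have piv y v X (Q : finGroupType) (pi : T -> Q) : fquot X pi -> X v ->
    pi (y ** v) = pi y.
  by move=> qX /(fquotP qX) e; rewrite (fquotM qX) e mulg1.
have [[r [oK [y [X [Q [pi [Gy oX XV qX eo]]]]]]]|noK] :=
  pselect (exists r, (K < r)%N /\ P r).
  exists y, X, Q, pi; split => //; split; first by rewrite eo (leq_ltn_trans K_gt0).
  apply: dense => // v Gv Xv; apply: contrapT => x1; have := piv y v X Q pi qX Xv => e.
  have Xx : X (gpow (y ** v) #[pi y]%g).
    by apply/(fquotP qX); rewrite (fquot_pow _ _ qX) e expg_order.
  have := order_le_K (subgroupM dense_subgroup Gy Gv) x1 oX XV Xx qX.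
  by rewrite e eo leqNgt oK.
pose Pb o := `[< P o >].
have exP : exists o, Pb o by have [r _ Pr] := P2; exists r; apply/asboolP.
have ubP o : Pb o -> (o <= K)%N.
  move/asboolP => Po; rewrite leqNgt; apply/negP => oK; apply: noK; by exists o.
case: (ex_maxnP exP ubP) => o /asboolP[y [X [Q [pi [Gy oX XV qX eo]]]]] maxo.
exists y, X, Q, pi; split => //; split.
  by rewrite eo; have [n n1 Pn] := P2; apply: leq_trans n1 _; apply/maxo/asboolP.
apply: dense => // v Gv Xv; apply: contrapT => x1; have e := piv y v X Q pi qX Xv.
have [Y [oY YX nY]] := open_normal_sep_in x1 oX.
have [Q' [pi' qY]] := open_fquot oY.
have dv := fquot_pow_sub (y ** v) qY qX YX; rewrite e in dv.
have /maxo : Pb #[pi' (y ** v)]%g.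
  apply/asboolP; exists (y ** v), Y, Q', pi'; split => //; first exact: (subgroupM dense_subgroup).
  exact: subset_trans XV.
rewrite -eo => le; have eq : #[pi' (y ** v)]%g = #[pi y]%g.
  by apply/eqP; rewrite eqn_leq le dvdn_leq.
by apply/nY/(fquotP qY); rewrite (fquot_pow _ _ qY) -eq expg_order.
Qed.

(** The bound on m = #|Q0| makes room for L batches: m <= K dim E and dim E <= kappa dim [E, y^k] +
    nu give dim [E, y^k] >= L (o - 1). The conclusion compares m |E| <= K d(H_1(U1)) with d(H_1(U1))
    <= (size lG * m)^2 |S|, after division by m |E|. *)
Lemma key_inequality y X0 o (F R : 'I_o.-1 -> seq T) kappa nu w p L
    (Q0 : finGroupType) (pi0 : T -> Q0) :
    G y -> open_normal X0 -> X0 `<=` V -> (1 < o)%N ->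
    (forall v, X0 v -> gpow (y ** v) o = one) ->
    (forall k : 'I_o.-1, normal_gen (gpow y k.+1) = gen [set` [seq gconj (gpow y k.+1) g | g <- F k]]) ->
    (forall (k : 'I_o.-1) x, G x -> exists2 r, r \in R k & normal_gen (gpow y k.+1) (inv r ** x)) ->
    (forall k, size (F k) <= kappa)%N -> (0 < kappa)%N -> (forall k, size (R k) <= nu)%N ->
    G w -> X0 w -> w <> one -> gpow w p = one -> prime p -> fquot (closed_normal_gen w) pi0 ->
    (K * nu + L * o.-1 * (K * kappa) <= #|Q0|)%N ->
  ((2 ^ o.-1) ^ L <= K * (size lG * size lG * #|Q0|) * (2 ^ o.-1 - 1) ^ L)%N.
Proof.
move=> Gy oX0 X0V o_gt1 exp_y nclF nclR leF kappa_gt0 leR Gw X0w w1 wp p_pr q0 leL.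
set U := closed_normal_gen w in q0; set m := #|Q0| in leL *.
have oU : open_normal U := closed_normal_gen_open_normal Gw w1.
have UX0 : U `<=` X0 := closed_normal_gen_sub oX0 X0w.
have UV : U `<=` V by exact: subset_trans X0V.
have [_ [sU _ nU]] := oU.
(* The index of X is |U:X| times |T:U|, at most p ^ m times m. *)
have [|U1 [oU1 CU1 U1U minU1]] := smallest_open_normal (b := p ^ m * m) oU.
  move=> X Q pi oX CX XU qX.
  have [E EU] := fquot_image qX sU XU.
  have [_ _ leE] := abelianization_closed_normal_gen Gw w1 wp p_pr erefl q0 oX CX XU qX EU.
  by rewrite (card_fquot qX q0 XU EU) leq_mul.
have [Q1 [pi1 q1]] := open_fquot oU1.
have [E EU] := fquot_image q1 sU U1U.
have [pE defE _] := abelianization_closed_normal_gen Gw w1 wp p_pr erefl q0 oU1 CU1 U1U q1 EU.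
have cardQ1 := card_fquot q1 q0 U1U EU; rewrite -/m in cardQ1.
have abE := abelem_abelian pE.
have nE := fquot_image_normal q1 oU.2 EU.
have NE q : (q \in 'N(E))%g by apply: (fintype.subsetP (normal_norm nE)); rewrite inE.
set D := logn p #|E|.
have cardE : #|E| = (p ^ D)%N := card_pgroup (abelem_pgroup pE).
have leD : (m <= K * D)%N.
  apply: (HK oU UV); last exact: (index_in_fquot profinite_groupA q0).
  exact: (ab_top_gen_abelem oU q1 U1U minU1 EU pE).
have commI k : exists I : {group Q1}, (I \subset E)%g /\
    forall q, q \in I <-> exists2 h, h \in E & q = [~ h, pi1 y ^+ k]%g.
  by apply: commutator_image_group.
pose J (i : 'I_L * 'I_o.-1) := projT1 (cid (commI i.2.+1)).
have JE i : (J i \subset E)%g by rewrite /J; case: cid => I [].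
have JP i q : q \in J i <-> exists2 h, h \in E & q = [~ h, pi1 y ^+ i.2.+1]%g.
  by rewrite /J; case: cid => I [].
have p_gt1 := prime_gt1 p_pr.
have leJ i : (p ^ #|{: 'I_L * 'I_o.-1}| <= #|J i|)%N.
  rewrite card_prod !card_ord (card_pgroup (pgroupS (JE i) (abelem_pgroup pE))) leq_exp2l //.
  set d := logn p #|J i|.
  have bd := @coinvariants_bound _ E (J i) (pi1 w) (pi1 y ^+ i.2.+1)%g p
    [seq pi1 g | g <- F i.2] [seq pi1 r | r <- R i.2] abE nE defE (ltnW p_gt1).
  have : (#|E| <= #|J i| ^ size (F i.2) * p ^ size (R i.2))%N.
    rewrite -[size (F _)](size_map pi1) -[size (R _)](size_map pi1); apply: bd => //.
    - by rewrite -(fquot_pow _ _ q1) wp (fquot1 profinite_groupA q1).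
    - by move=> h hE; apply/JP; exists h.
    - move=> x; have [g Gg <-] : exists2 g, G g & pi1 g = x.
        have [z <-] := fquot_surj q1 x; exact: (fquot_dense z oU1.1 q1).
      have [r rR Nr] := nclR i.2 g Gg.
      exists (pi1 r); first exact: map_f.
      exists (pi1 (inv r ** g)); last by rewrite -(fquotM q1) (gmulVK profinite_groupA).
      rewrite nclF in Nr.
      apply: (fquot_gen_sub (D := <<_>>%G) q1 _ Nr) => _ /mapP[h hF ->].
      rewrite (fquotJ profinite_groupA q1) (fquot_pow _ _ q1); apply: mem_gen.
      by apply/imsetP; exists (pi1 h) => //; exact: map_f.
  rewrite cardE (card_pgroup (pgroupS (JE i) (abelem_pgroup pE))) -/d -expnM -expnD leq_exp2l // => leDd.
  have le1 : (D <= d * kappa + nu)%N.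
    by apply: leq_trans leDd _; rewrite leq_add ?leq_mul.
  have le2 : (K * nu + L * o.-1 * (K * kappa) <= K * nu + d * (K * kappa))%N.
    apply: leq_trans leL _; apply: leq_trans leD _.
    apply: leq_trans (leq_mul (leqnn K) le1) _.
    by rewrite mulnDr addnC [(K * (d * _))%N]mulnCA.
  by move: le2; rewrite leq_add2l leq_pmul2r // muln_gt0 K_gt0.
have [a aJ card_a] := independent_choice p_pr pE JE leJ.
have aP i := (JP i (a i)).1 (aJ i).
pose h i k : Q1 := projT1 (cid2 (aP (i, k))).
have hE i k : h i k \in E by rewrite /h; case: cid2.
have ha i k : a (i, k) = [~ h i k, pi1 y ^+ k.+1]%g by rewrite /h; case: cid2.
have card_c : #|<<[set [~ h i.1 i.2, pi1 y ^+ i.2.+1] | i : 'I_L * 'I_o.-1]%SET>>%g| = (p ^ (L * o.-1))%N.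
  rewrite -[(L * o.-1)%N](_ : #|{: 'I_L * 'I_o.-1}| = _); last by rewrite card_prod !card_ord.
  rewrite -card_a; congr #|<<_>>%g|; apply: eq_imset => -[l k] /=.
  by rewrite ha.
have [S [sSE cardS spanS]] := reduced_spanning_set p_pr pE (NE (pi1 y)) (ltnW o_gt1) hE card_c.
(* Schreier generators of the intersection of G and U, size lG * m in number; by density they
   generate U modulo every X. *)
have [lU size_lU defU] := schreier profinite_groupA defG (subgroupI dense_subgroup sU)
  (fun z Hz => Hz.1) (index_dense oU.1 q0 sU).
have lUU u : u \in lU -> U u.
  by move=> ul; have : gen [set` lU] u by [apply: gen_incl]; rewrite -defU => -[].
have genU X (Q : finGroupType) (pi : T -> Q) u : open_normal X -> X `<=` U ->
    fquot X pi -> U u -> exists2 g, gen [set` lU] g & pi g = pi u.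
  move=> oX XU qX Uu; have [g Gg eg] := fquot_dense u oX.1 qX.
  exists g => //; rewrite -defU; split => //.
  have /(fquot_eq profinite_groupA qX)/XU Uug := esym eg.
  by rewrite -(gmulVK profinite_groupA u g); exact: (subgroupM sU).
pose sigma q := projT1 (cid (fquot_surj q1 q)).
have sigmaE q : pi1 (sigma q) = q by rewrite /sigma; case: cid.
have genU1 := ab_top_gen_commutators oU oU1 CU1 U1U q1 minU1 EU
  (fun v Uv => exp_y v (UX0 v Uv)) lUU genU sigmaE spanS.
have := HK oU1 (subset_trans U1U UV) genU1 (index_in_fquot profinite_groupA q1).
rewrite cardQ1 size_lU -/m => leQ.
have cS := spanning_count p_pr cardS.
have E_gt0 : (0 < #|E|)%N := cardG_gt0 E.
have m_gt0 : (0 < m)%N by rewrite /m -(finset.cardsT Q0) (cardG_gt0 [set: Q0]%G).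
rewrite -(leq_pmul2l (_ : 0 < #|E| * m)%N) ?muln_gt0 ?E_gt0 //.
apply: leq_trans (leq_mul leQ (leqnn _)) _.
set A := size lG; set q := (2 ^ o.-1)%N in cS *.
have -> : (K * (A * m * (A * m) * #|S|) * q ^ L = K * (A * m * (A * m)) * (#|S| * q ^ L))%N.
  by rewrite !mulnA.
apply: leq_trans (leq_mul (leqnn _) cS) _.
by apply: eq_leq; move: (_ ^ L)%N => B; move: #|E| => e; lia.
Qed.

Lemma dense_meets_open_normal X : open_normal X -> exists x, [/\ G x, X x & x <> one].
Proof.
move=> oX; have [Q [pi qX]] := open_fquot oX.
apply: contrapT => nox; apply: infG.
pose s q := xget one [set g | G g /\ pi g = q].
apply: (sub_finite_set (B := range s)); last exact/finite_image/finite_finset.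
move=> g Gg; exists (pi g) => //.
have [Gs es] : G (s (pi g)) /\ pi (s (pi g)) = pi g.
  by have := @xgetPex _ one [set h | G h /\ pi h = pi g] (ex_intro _ g (conj Gg erefl)).
apply: contrapT => ne; apply: nox; exists (inv (s (pi g)) ** g); split.
- by apply: (subgroupM dense_subgroup) => //; exact: (subgroupV dense_subgroup).
- exact/(fquot_eq profinite_groupA qX).
- by move=> e; apply: ne; have := gmulVK profinite_groupA (s (pi g)) g; rewrite e (gmulx1 profinite_groupA).
Qed.

Lemma large_index X N : open_normal X -> exists2 W, open_normal W /\ W `<=` X &
  forall (Q : finGroupType) (pi : T -> Q), fquot W pi -> (N <= #|Q|)%N.
Proof.
move=> oX; elim: N => [|N [W [oW WX] leN]]; first by exists X => //; split.
have [x [Gx Wx x1]] := dense_meets_open_normal oW.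
have [W' [oW' W'W nW'x]] := open_normal_sep_in x1 oW.
exists W' => [|Q' pi' qW']; first by split => //; exact: subset_trans WX.
have [Q [pi qW]] := open_fquot oW.
have [_ [sW _ _]] := oW; have [E EW] := fquot_image qW' sW W'W.
rewrite (card_fquot qW' qW W'W EW); have leQ := leN _ _ qW.
have E1 : (1 < #|E|)%N.
  rewrite cardG_gt1; apply/trivgPn; exists (pi' x); first exact/EW.
  by apply/eqP => e; apply: nW'x; exact/(fquotP qW').
have Q0 : (0 < #|Q|)%N by rewrite -(finset.cardsT Q) (cardG_gt0 [set: Q]%G).
apply: leq_ltn_trans leQ _; exact: ltn_Pmull.
Qed.

Lemma prime_order_element X : open_normal X -> exists w p,
  [/\ G w, X w, w <> one, prime p & gpow w p = one].
Proof.
move=> oX; have [x [Gx Xx x1]] := dense_meets_open_normal oX.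
have [n0 n0_gt0 xn0] := torsion_dense Gx.
have exn : exists n, (0 < n)%N && `[< gpow x n = one >].
  by exists n0; rewrite n0_gt0; apply/asboolP.
case: (ex_minnP exn) => n /andP[n_gt0 /asboolP xn] minn.
have n1 : (1 < n)%N.
  by case: n n_gt0 xn {minn} => [|[|n]] // _; rewrite /= (gmulx1 profinite_groupA).
have pd := pdiv_dvd n; have p_pr := pdiv_prime n1.
exists (gpow x (n %/ pdiv n)), (pdiv n); split => //.
- exact: (gpow_in _ dense_subgroup).
- by have [_ [sX _ _]] := oX; exact: (gpow_in _ sX).
- move=> e; have d_gt0 : (0 < n %/ pdiv n)%N by rewrite divn_gt0 ?pdiv_leq // pdiv_gt0.
  have := minn (n %/ pdiv n)%N; rewrite d_gt0 /= => /(_ (introT (asboolP _) e)).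
  by rewrite leqNgt ltn_Pdiv // prime_gt1.
- by rewrite (gpowM) divnK.
Qed.

Lemma positive_gradient_false : False.
Proof.
have [y [X [Q [pi [Gy oX XV qX [lt1o exp_y]]]]]] := coset_exponent.
set o := #[pi y]%g in lt1o exp_y.
have yk (k : 'I_o.-1) : gpow y k.+1 <> one.
  move=> e; have := fquot_pow y k.+1 qX; rewrite e (fquot1 profinite_groupA qX) => /esym/eqP.
  rewrite -order_dvdn -/o => /dvdn_leq; case: k {e} => k /= kn; lia.
have cst (k : 'I_o.-1) := normal_gen_generators_reps (gpow_in k.+1 dense_subgroup Gy) (yk k).
have [FR FRP] := choice cst.
pose F k := (FR k).1; pose R k := (FR k).2.
(* The successor keeps [kappa], and with it the divisor [B], positive. *)
pose kappa := (\max_(k < o.-1) size (F k)).+1.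
pose nu := (\max_(k < o.-1) size (R k))%N.
have leF k : (size (F k) <= kappa)%N by apply/leqW/(leq_bigmax k).
have leR k : (size (R k) <= nu)%N by exact: (leq_bigmax k).
pose B := (o.-1 * (K * kappa))%N.
have n_gt0 : (0 < o.-1)%N by lia.
have B_gt0 : (0 < B)%N by rewrite !muln_gt0 n_gt0 K_gt0.
have q_gt1 : (1 < 2 ^ o.-1)%N by rewrite -[1%N](expn0 2) ltn_exp2l.
(* By [ltL] below, m is at most (K nu + B) (L + 1), which turns the factor m of [key_inequality]
   into one linear in L with this constant. *)
have [L0 HL0] := exp_beats_linear (K * (size lG * size lG) * (K * nu + B)) q_gt1.
have [W [oW WX] leW] := large_index (K * nu + L0 * B) oX.
have [w [p [Gw Ww w1 p_pr wp]]] := prime_order_element oW.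
have oU := closed_normal_gen_open_normal Gw w1.
have UW : closed_normal_gen w `<=` W := closed_normal_gen_sub oW Ww.
have [Q0 [pi0 q0]] := open_fquot oU.
have [QW [piW qW]] := open_fquot oW.
have leQ : (K * nu + L0 * B <= #|Q0|)%N.
  apply: leq_trans (leW _ _ qW) _.
  have [_ [sW _ _]] := oW; have [E EW] := fquot_image q0 sW UW.
  by rewrite (card_fquot q0 qW UW EW) leq_pmull.
(* The largest number of batches that [key_inequality] admits. *)
pose L := ((#|Q0| - K * nu) %/ B)%N.
have L0L : (L0 <= L)%N by rewrite leq_divRL //; lia.
have LB : (L * B <= #|Q0| - K * nu)%N by exact: leq_trunc_div.
have leL : (K * nu + L * o.-1 * (K * kappa) <= #|Q0|)%N by rewrite -mulnA -/B; lia.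
have ltL : (#|Q0| <= (K * nu + B) * L.+1)%N.
  have := ltn_ceil (#|Q0| - K * nu) B_gt0; rewrite -/L; nia.
have key := key_inequality Gy oX XV lt1o exp_y
  (fun k => (FRP k).1) (fun k => (FRP k).2) leF (ltn0Sn _) leR Gw (WX w Ww) w1 wp p_pr q0 leL.
have := leq_trans (HL0 L L0L) key; rewrite ltnNge => /negP; apply.
rewrite leq_mul2r; apply/orP; right.
rewrite !mulnA -[(_ * (K * nu + B) * _)%N]mulnA leq_mul2l ltL orbT //.
Qed.

End Profinite.

Theorem theorem1p3 (T : topologicalType) (mul : T -> T -> T) (inv : T -> T) (one : T)
  (Gamma : set T) :
  profinite_group mul inv one ->
  fin_gen mul inv one Gamma ->
  closure Gamma = [set: T] ->
  just_infinite mul inv one Gamma ->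
  normal_homology_rank_gradient mul inv one = 0%E.
Proof.
move=> PG [d [s defG]] dG [_ [infG jiG]].
have {}defG : Gamma = gen mul inv one [set` [seq s i | i <- enum 'I_d]].
  rewrite defG; congr gen; apply/seteqP; split=> [_ [i _ <-]|x /mapP[i _ ->]].
    by apply: map_f; rewrite mem_enum.
  by exists i.
apply: gradient_eq0 => V K oV; apply: contrapT => noU.
(* K + 1 instead of K, since the constant has to be positive; m > (K + 1) n still gives m > K n. *)
apply: (positive_gradient_false PG defG dG jiG infG (ltn0Sn K) oV) => U n m oU UV Un Um.
rewrite leqNgt; apply/negP => ltm; apply: noU; exists U, n, m; split => //.
by apply: leq_ltn_trans ltm; rewrite leq_mul2r leqnSn orbT.
Qed.
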